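(* Let $K\subset\mathbb R^n$ be compact and let $0\le s<t$. Then the embedding $B^t_K\hookrightarrow B^s$ is compact.
   Context: Functions are complex valued on $\mathbb R^n$; $\hat f(\xi)=\int_{\mathbb R^n}e^{-ix\cdot\xi}f(x)\,dx$ is the Fourier transform (extended to tempered distributions); $\langle\xi\rangle=\sqrt{1+|\xi|^2}$; $C_b^0$ is the space of bounded continuous functions on $\mathbb R^n$. For $s\ge0$, $B^s=\{f\in C_b^0:\ \langle\xi\rangle^s\hat f\in L^1(\mathbb R^n)\}$ with norm $\|f\|_{B^s}=\|\langle\xi\rangle^s\hat f\|_{L^1}$ (a Banach space). For $K\subset\mathbb R^n$ compact, $B^s_K=\{f\in B^s:\ \mathrm{supp}\,f\subset K\}$, equipped with the norm $\|\cdot\|_{B^s}$. *)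

(* Defs.v *)
From HB Require Import structures.
From mathcomp Require Import all_boot all_order all_algebra.
From mathcomp Require Import all_classical all_reals all_analysis.
From mathcomp Require Import complex.
Set Implicit Arguments.
Unset Strict Implicit.
Unset Printing Implicit Defensive.
Import Order.TTheory GRing.Theory Num.Theory.
Import numFieldNormedType.Exports.
Local Open Scope classical_set_scope.
Local Open Scope complex_scope.
Local Open Scope ring_scope.

(* MathComp-Analysis. [R : realType] is the field of real numbers, ['rV[R]_n]
   is R^n with the library's topology, [R[i]] is the field of complex
   numbers. *)

Definition rV_display : measure_display.
Proof. exact: default_measure_display. Qed.

(* The sigma-algebra on R^n generated by the coordinates, i.e. the n-fold
   product of the Borel sigma-algebra of R. *)
Section measurable_rV.
Context {R : realType} (n : nat).

Let coors : 'I_n -> 'rV[R]_n -> R := fun i x => x ord0 i.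

Let rV_set0 : g_sigma_preimage coors set0.
Proof. exact: sigma_algebra0. Qed.

Let rV_setC A : g_sigma_preimage coors A -> g_sigma_preimage coors (~` A).
Proof. exact: sigma_algebraC. Qed.

Let rV_bigcup (F : _^nat) : (forall i, g_sigma_preimage coors (F i)) ->
  g_sigma_preimage coors (\bigcup_i (F i)).
Proof. exact: sigma_algebra_bigcup. Qed.

HB.instance Definition _ := @isMeasurable.Build rV_display 'rV[R]_n
  (g_sigma_preimage coors) rV_set0 rV_setC rV_bigcup.

End measurable_rV.

Lemma measurable_fun_rVP d (T : measurableType d) (R : realType) n
    (f : T -> 'rV[R]_n) :
  measurable_fun [set: T] f <->
  forall i, measurable_fun [set: T] (fun x => f x ord0 i).
Proof.
pose co i (x : 'rV[R]_n) : R := x ord0 i.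
apply: (@iff_trans _ (g_sigma_preimage (fun i => co i \o f) `<=` measurable)).
  rewrite g_sigma_preimage_comp; split=> [mf A [/= C preC <-]|prefS].
    exact: mf.
  by move=> _ A mA; apply: prefS; exists A.
split=> [cofS i|mf].
- move=> _ A mA; apply: cofS; apply: sub_sigma_algebra.
  case: n => [|n] in f co i *; first by case: i.
  rewrite -bigcup_mkord_ord.
  exists i; first exact: ltn_ord.
  by exists A => //; rewrite inord_val.
- apply: smallest_sub; first exact: sigma_algebra_measurable.
  case: n => [|n] in f co mf *; first by rewrite big_ord0.
  rewrite -bigcup_mkord_ord; apply: bigcup_sub => i Ii.
  by move=> A [B mB <-]; exact: mf.
Qed.

Section rV_cons.
Context {R : realType} {n : nat}.

Definition rV_cons (p : measurableTypeR R * 'rV[R]_n) : 'rV[R]_n.+1 :=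
  \row_i oapp (fun j => p.2 ord0 j) p.1 (unlift ord0 i).

Definition rV_uncons (x : 'rV[R]_n.+1) : measurableTypeR R * 'rV[R]_n :=
  (x ord0 ord0, \row_j x ord0 (lift ord0 j)).

Lemma rV_consK : cancel rV_cons rV_uncons.
Proof.
move=> [a v]; congr (_, _); first by rewrite mxE unlift_none.
by apply/rowP => j; rewrite !mxE liftK.
Qed.

Lemma measurable_coord (i : 'I_n) :
  measurable_fun setT (fun x : 'rV[R]_n => x ord0 i).
Proof. by move: i; apply/measurable_fun_rVP; exact: measurable_id. Qed.

End rV_cons.

Lemma measurable_rV_cons (R : realType) n :
  measurable_fun setT (@rV_cons R n).
Proof.
apply/measurable_fun_rVP => i.
under eq_fun do rewrite mxE; case: (unlift ord0 i) => [j|] /=.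
- exact: (measurableT_comp (measurable_coord j)).
- exact: measurable_fst.
Qed.

Lemma measurable_rV_uncons (R : realType) n :
  measurable_fun setT (@rV_uncons R n).
Proof.
apply: measurable_fun_pair; first exact: measurable_coord.
apply/measurable_fun_rVP => i; under eq_fun do rewrite mxE.
exact: measurable_coord.
Qed.

Section lebesgue_rV_succ.
Context {R : realType} (n : nat).
Variable m : {sigma_finite_measure set 'rV[R]_n -> \bar R}.

Definition lebesgue_rV_succ : set 'rV[R]_n.+1 -> \bar R :=
  pushforward (lebesgue_measure \x m)%E rV_cons.

HB.instance Definition _ := Measure.copy lebesgue_rV_succ
  (measure_function_pushforward__canonical__measure_function_Measure
    (lebesgue_measure \x m)%E (@measurable_rV_cons R n)).

Let lebesgue_rV_succ_sigma_finite : sigma_finite setT lebesgue_rV_succ.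
Proof.
have /sigma_finiteP[F [TF ndF Foo]] := sigma_finiteT (@lebesgue_measure R).
have /sigma_finiteP[G [TG ndG Goo]] := sigma_finiteT m.
exists (fun k => rV_uncons @^-1` (F k `*` G k)).
  rewrite -preimage_bigcup; apply/esym/seteqP; split=> // x _.
  have [i _ Fi] : (\bigcup_k F k) (rV_uncons x).1 by rewrite -TF.
  have [j _ Gj] : (\bigcup_k G k) (rV_uncons x).2 by rewrite -TG.
  exists (maxn i j) => //; split.
  - by apply: subsetPset Fi; exact/ndF/leq_maxl.
  - by apply: subsetPset Gj; exact/ndG/leq_maxr.
move=> k; have [mF Fk] := Foo k; have [mG Gk] := Goo k; split.
  rewrite -[X in measurable X]setTI.
  by apply: measurable_rV_uncons => //; exact: measurableX.
rewrite /lebesgue_rV_succ /pushforward -comp_preimage.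
rewrite (_ : _ \o _ = id); last by apply/funext => p /=; rewrite rV_consK.
rewrite preimage_id product_measure1E//.
by rewrite lte_mul_pinfty// ge0_fin_numE.
Qed.

HB.instance Definition _ := Measure_isSigmaFinite.Build _ _ _ lebesgue_rV_succ
  lebesgue_rV_succ_sigma_finite.

End lebesgue_rV_succ.

(* Lebesgue measure on R^n, under the identification R^(n+1) = R x R^n; on R^0
   it is the unit mass. *)
Fixpoint lebesgue_rV (R : realType) n :
    {sigma_finite_measure set 'rV[R]_n -> \bar R} :=
  if n is k.+1 then lebesgue_rV_succ (lebesgue_rV R k) else dirac (0 : 'rV[R]_0).

Section complex_functions.
Context {R : realType} {n : nat}.
Local Notation Rn := 'rV[R]_n.
Local Notation mu := (lebesgue_rV R n).
(* not the [Re] and [Im] of numClosedFieldType, whose values are in [R[i]] *)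
Local Notation Re := (@complex.Re R).
Local Notation Im := (@complex.Im R).
Implicit Types f g : Rn -> R[i].

Definition cmeasurable f :=
  measurable_fun setT (fun x => Re (f x)) /\
  measurable_fun setT (fun x => Im (f x)).

Definition cintegrable f :=
  mu.-integrable setT (fun x => (Re (f x))%:E) /\
  mu.-integrable setT (fun x => (Im (f x))%:E).

Definition cintegral f : R[i] :=
  (\int[mu]_x Re (f x)) +i* (\int[mu]_x Im (f x)).

Definition dotp (x y : Rn) : R := \sum_i x ord0 i * y ord0 i.

(* <x> = sqrt (1 + |x|^2), with |x| the Euclidean norm; the norm of the
   library on 'rV[R]_n is the sup norm. *)
Definition japanese (x : Rn) : R := Num.sqrt (1 + dotp x x).

(* exp (- i theta) *)
Definition expNi (theta : R) : R[i] := cos theta -i* sin theta.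

Definition fourier f : Rn -> R[i] :=
  fun xi => cintegral (fun x => expNi (dotp x xi) * f x).

Definition partials (l : seq 'I_n) (u : Rn -> R) : Rn -> R :=
  foldr (fun i v x => 'D_(delta_mx ord0 i) v x) u l.

Definition smooth (u : Rn -> R) := forall l : seq 'I_n,
  continuous (partials l u) /\
  forall i x, derivable (partials l u) x (delta_mx ord0 i).

Definition real_schwartz (u : Rn -> R) := smooth u /\
  forall (l : seq 'I_n) (N : nat),
    exists C : R, forall x, japanese x ^+ N * `|partials l u x| <= C.

Definition schwartz f :=
  real_schwartz (fun x => Re (f x)) /\ real_schwartz (fun x => Im (f x)).

(* A measurable function of at most polynomial growth in the L^1 sense defines
   a tempered distribution. *)
Definition tempered f := cmeasurable f /\
  exists N : nat, cintegrable (fun x => ((japanese x)^-1 ^+ N)%:C * f x).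

Definition distr f : (Rn -> R[i]) -> R[i] :=
  fun phi => cintegral (fun x => f x * phi x).

Definition fourier_distr (T : (Rn -> R[i]) -> R[i]) : (Rn -> R[i]) -> R[i] :=
  fun phi => T (fourier phi).

(* The Fourier transform of the tempered distribution f is the function g. *)
Definition is_fourier f g := tempered g /\
  forall phi, schwartz phi -> fourier_distr (distr f) phi = distr g phi.

(* The function g such that [is_fourier f g], which is unique up to equality
   almost everywhere; 0 if there is none. *)
Definition fhat f : Rn -> R[i] := xget (fun=> 0) [set g | is_fourier f g].

Definition bounded_continuous f := continuous (f : Rn -> R[i]^o) /\
  exists M : R, forall x, `|f x| <= M%:C.

Definition Bspace (s : R) : set (Rn -> R[i]) := [set f |
  [/\ bounded_continuous f, exists g, is_fourier f g &
      cintegrable (fun xi => (japanese xi `^ s)%:C * fhat f xi)]].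

Definition Bnorm (s : R) f : \bar R :=
  (\int[mu]_xi (japanese xi `^ s * Normc.normc (fhat f xi))%:E)%E.

Definition csupp f : set Rn := closure [set x | f x != 0].

Definition BspaceK (K : set Rn) (s : R) : set (Rn -> R[i]) :=
  [set f | Bspace s f /\ csupp f `<=` K].

End complex_functions.

(* The normed space X, with norm nX, embeds compactly in the normed space Y,
   with norm nY: X is contained in Y, the inclusion is continuous, and every
   bounded sequence of X has a subsequence which converges in Y. *)
Definition compact_embedding (R : realType) (V : zmodType)
    (X : set V) (nX : V -> \bar R) (Y : set V) (nY : V -> \bar R) :=
  [/\ X `<=` Y,
      exists C : R, forall f, X f -> (nY f <= C%:E * nX f)%E &
      forall u : nat -> V, (forall k, X (u k)) ->
        (exists M : R, forall k, (nX (u k) <= M%:E)%E) ->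
        exists2 sigma : nat -> nat, {homo sigma : i j / (i < j)%N} &
        exists2 f, Y f & (nY (u (sigma k) - f) @[k --> \oo] --> 0%E)].

(* Main.v *)
(* Let f be continuous and supported in a fixed box.  Its Fourier transform is
   the classical one, because the distributional one is unique; this uniqueness
   is obtained by testing against smooth cut-offs of products of half-lines,
   which form a pi-system.  If fourier f is integrable, then sup |f| is bounded
   by a multiple of the L^1 norm of fourier f: damp the inversion formula by
   exp (- e |.|_1), whose transform is a product of Cauchy kernels.  So a
   sequence u_k bounded in B^t_K is uniformly bounded with supports in a box,
   hence the functions fourier u_k are uniformly bounded and equi-Lipschitz, and
   a subsequence converges pointwise.  Since
     <xi>^s <= d <xi>^t + C_d k(xi)
   for every d > 0, with k an integrable kernel, Fatou and dominated convergence
   give convergence in L^1 with the weight <xi>^s.  By the sup bound the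
   subsequence of the u_k is then uniformly Cauchy, and its limit is the limit
   in B^s. *)
Require Import Defs.
From HB Require Import structures.
From mathcomp Require Import all_boot all_order all_algebra.
From mathcomp Require Import all_classical all_reals all_analysis.
From mathcomp Require Import measurable_realfun complex ring lra.
Set Implicit Arguments.
Unset Strict Implicit.
Unset Printing Implicit Defensive.
Import Order.TTheory GRing.Theory Num.Theory.
Import numFieldNormedType.Exports.
Local Open Scope classical_set_scope.
Local Open Scope ring_scope.

(** * Integration on R^n *)

(** [fhat f] is a representative picked by [xget], determined only almost everywhere, so no
    pointwise argument can be made on it. Everything is transferred to [fourier f], which is defined
    at every point and is Lipschitz because f lives in a box. For uniqueness the tests must be
    Schwartz in the sense of iterated partial derivatives: products of factors exp (- x^2 + b x -
    exp (q - p x)) are used because their derivatives stay in an explicit class, while with suitable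
    parameters they tend to a Gaussian times the indicator of an orthant. Damping by exp (- e |.|_1)
    reduces the inversion bound to an integral with an elementary antiderivative in each variable.
    The Cauchy kernel, the product of the 1 / (1 + x_i^2), has three roles: approximate identity in
    the inversion bound, integrable majorant for functions supported in the box, and weight on low
    frequencies in the interpolation of <xi>^s. The strict inequality s < t enters in that
    interpolation: at high frequencies <xi>^(s - t) is small. *)

Lemma cvg_rV (T : Type) (F : set_system T) (FF : Filter F) (R : realType) n
    (u : T -> 'rV[R]_n) (l : 'rV[R]_n) :
  (forall i, u x ord0 i @[x --> F] --> l ord0 i) -> u x @[x --> F] --> l.
Proof.
move=> ul A [P lP PA]; rewrite nbhs_filterE/=.
have : \forall x \near F, forall ij : 'I_1 * 'I_n, P ij.1 ij.2 (u x ij.1 ij.2).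
  by apply: filter_forall => -[i j] /=; rewrite (ord1 i); exact/ul/lP.
by apply: filterS => x Px; apply: PA => i j; exact: (Px (i, j)).
Qed.

Section continuous_measurable_rV.
Variables (R : realType) (n : nat).

Let grid (m : nat) (z : 'rV[int]_n) : 'rV[R]_n :=
  \row_i ((z ord0 i)%:~R / m.+1%:R).
Let cell (m : nat) (x : 'rV[R]_n) : 'rV[int]_n :=
  \row_i Num.floor (m.+1%:R * x ord0 i).

Let measurable_cell m z : measurable [set x : 'rV[R]_n | cell m x = z].
Proof.
have -> : [set x : 'rV[R]_n | cell m x = z] = \bigcap_(i in [set: 'I_n])
    ((fun x : 'rV[R]_n => m.+1%:R * x ord0 i) @^-1`
      `[(z ord0 i)%:~R, (z ord0 i + 1)%:~R[).
  apply/seteqP; split => x /=.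
    by move=> <- i _ /=; rewrite in_itv/= mxE; exact: floor_itv.
  move=> xz; apply/rowP => i; rewrite mxE; apply: floor_def.
  by have /= := xz i I; rewrite in_itv.
apply: fin_bigcap_measurable => [|i _]; first exact: finite_finset.
rewrite -[X in measurable X]setTI.
have : measurable_fun setT (fun x : 'rV[R]_n => m.+1%:R * x ord0 i).
  by apply: measurable_funM => //; exact: measurable_coord.
by apply => //; exact: measurable_itv.
Qed.

(** The sigma-algebra is generated by the coordinates, so open sets are not measurable by
    definition. The function is instead a pointwise limit of its values at the lower corners of the
    grid cells of side 1 / m.+1, and each approximation takes countably many values on measurable
    cells. *)
Lemma continuous_measurable_rV (f : 'rV[R]_n -> R) :
  continuous f -> measurable_fun setT f.
Proof.
move=> cf.
apply: (@measurable_realfun.measurable_fun_cvg _ _ _ _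
   (fun m x => f (grid m (cell m x)))).
  move=> m _ Y mY; rewrite setTI.
  (* [pickle] numbers the integer vectors, which turns the union over cells into a countable one;
     codes of no vector contribute the empty set. *)
  have -> : (fun x => f (grid m (cell m x))) @^-1` Y =
     \bigcup_k (if unpickle k is Some z then
       (if f (grid m z) \in Y then [set x | cell m x = z] else set0) else set0).
    apply/seteqP; split => x /=.
      move=> Yx; exists (pickle (cell m x)) => //.
      by rewrite pickleK mem_set.
    case=> k _; case: (unpickle k) => // z.
    by case: ifPn => // /set_mem Yz /= ->.
  apply: bigcupT_measurable => k; case: (unpickle k) => // z.
  by case: ifPn => // _; exact: measurable_cell.
move=> x _.
apply: (@cvg_comp _ _ _ (fun m => grid m (cell m x)) f _ (nbhs x)); last exact: cf.
apply: cvg_rV => i; rewrite /grid /cell.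
apply: (@squeeze_cvgr _ _ _ _ (fun m => x ord0 i - m.+1%:R^-1) (fun m => x ord0 i)).
- near=> m; rewrite !mxE.
  have /andP[h1 h2] := floor_itv (m.+1%:R * x ord0 i).
  have m0 : 0 < m.+1%:R :> R by rewrite ltr0n.
  apply/andP; split; last by rewrite ler_pdivrMr// (mulrC (x _ _)).
  rewrite ler_pdivlMr// mulrBl mulVf ?gt_eqF// (mulrC (x _ _)).
  by rewrite lerBlDr; apply: ltW; move: h2; rewrite intrD mulr1z.
- have : (fun m => x ord0 i - m.+1%:R^-1) @ \oo --> x ord0 i - 0.
    by apply: cvgB; [exact: cvg_cst|exact: cvg_harmonic].
  by rewrite subr0.
- exact: cvg_cst.
Unshelve. all: by end_near. Qed.

End continuous_measurable_rV.

Section lebesgue_rV_theory.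
Variable R : realType.
Local Notation leb := (@lebesgue_measure R).

Lemma integral_rV0 (f : 'rV[R]_0 -> \bar R) :
  measurable_fun setT f -> (\int[lebesgue_rV R 0]_x f x = f 0%R)%E.
Proof. by move=> mf; rewrite integral_dirac// diracT mul1e. Qed.

Lemma ge0_integral_rVS n (f : 'rV[R]_n.+1 -> \bar R) :
  measurable_fun setT f -> (forall x, 0 <= f x)%E ->
  (\int[lebesgue_rV R n.+1]_x f x =
   \int[leb]_a \int[lebesgue_rV R n]_v f (rV_cons (a, v)))%E.
Proof.
move=> mf f0.
have mc : measurable_fun setT (fun p => f (@rV_cons R n p)).
  by apply: (measurableT_comp mf); exact: measurable_rV_cons.
rewrite (@ge0_integral_pushforward _ _ _ _ _ _ (@measurable_rV_cons R n)
  (leb \x lebesgue_rV R n)%E)//=.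
by rewrite fubini_tonelli1.
Qed.

Lemma integrable_rVS n (f : 'rV[R]_n.+1 -> \bar R) :
  (lebesgue_rV R n.+1).-integrable setT f ->
  (leb \x lebesgue_rV R n)%E.-integrable setT (f \o @rV_cons R n).
Proof.
move=> /integrableP[mf foo]; apply/integrableP; split.
  by apply: (measurableT_comp mf); exact: measurable_rV_cons.
move: foo; rewrite (@ge0_integral_pushforward _ _ _ _ _ _ (@measurable_rV_cons R n)
  (leb \x lebesgue_rV R n)%E)//=.
exact: measurableT_comp.
Qed.

Lemma integral_rVS n (f : 'rV[R]_n.+1 -> \bar R) :
  (lebesgue_rV R n.+1).-integrable setT f ->
  (\int[lebesgue_rV R n.+1]_x f x =
   \int[leb]_a \int[lebesgue_rV R n]_v f (rV_cons (a, v)))%E.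
Proof.
move=> fi.
rewrite (@integral_pushforward _ _ _ _ _ _ (@measurable_rV_cons R n)
  (leb \x lebesgue_rV R n)%E)//=.
- by rewrite -integral12_prod_meas1//; exact: integrable_rVS.
- exact: measurable_int fi.
- exact: integrable_rVS.
Qed.

Lemma prod_rV_cons n (g : R -> R) a (v : 'rV[R]_n) :
  \prod_i g (rV_cons (a, v) ord0 i) = g a * \prod_i g (v ord0 i).
Proof.
rewrite big_ord_recl; congr (g _ * _); first by rewrite mxE unlift_none.
by apply: eq_bigr => i _; rewrite mxE liftK.
Qed.

Lemma measurable_prod_rV n (g : R -> R) : measurable_fun setT g ->
  measurable_fun setT (fun x : 'rV[R]_n => \prod_i g (x ord0 i)).
Proof.
move=> mg; apply: measurable_prod => i _.
by apply: (measurableT_comp mg); exact: measurable_coord.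
Qed.

Lemma integral_prod_rV n (g : R -> R) : measurable_fun setT g ->
  (forall x, 0 <= g x) ->
  (\int[lebesgue_rV R n]_x (\prod_i g (x ord0 i))%:E =
   (\int[leb]_x (g x)%:E) ^+ n)%E.
Proof.
move=> mg g0; elim: n => [|n IH].
  rewrite integral_rV0; first by rewrite big_ord0 expe0.
  by apply/measurable_EFinP; exact: measurable_prod_rV.
have mp k : measurable_fun setT (fun x : 'rV[R]_k => (\prod_i g (x ord0 i))%:E).
  by apply/measurable_EFinP; exact: measurable_prod_rV.
have p0 k (x : 'rV[R]_k) : (0 <= (\prod_i g (x ord0 i))%:E)%E.
  by rewrite lee_fin; exact: prodr_ge0.
rewrite ge0_integral_rVS//.
have H a : (\int[lebesgue_rV R n]_v (\prod_i g (rV_cons (a, v) ord0 i))%:E =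
    (g a)%:E * (\int[leb]_x (g x)%:E) ^+ n)%E.
  rewrite -IH -ge0_integralZl ?lee_fin//; last exact: mp.
  by apply: eq_integral => v _; rewrite prod_rV_cons EFinM.
under eq_integral do rewrite H.
rewrite ge0_integralZr//; first by rewrite expeS.
- exact/measurable_EFinP.
- by move=> x _; rewrite lee_fin.
- by rewrite -IH; apply: integral_ge0 => x _.
Qed.

Lemma integrable_prod_rV n (g : R -> R) :
  (forall x, 0 <= g x) -> leb.-integrable setT (EFin \o g) ->
  (lebesgue_rV R n).-integrable setT (fun x => (\prod_i g (x ord0 i))%:E).
Proof.
move=> g0 /integrableP[/measurable_EFinP mg goo].
apply/integrableP; split.
  by apply/measurable_EFinP; exact: measurable_prod_rV.
under eq_integral do rewrite gee0_abs ?lee_fin ?prodr_ge0//.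
rewrite integral_prod_rV//.
have : (\int[leb]_x (g x)%:E \is a fin_num)%E.
  rewrite ge0_fin_numE; last by apply: integral_ge0 => x _; rewrite lee_fin.
  by under eq_integral do rewrite -[(g _)%:E]gee0_abs ?lee_fin//.
by move=> /fineK <-; rewrite -EFin_expe ltry.
Qed.

Lemma measurable_affine1 (b e : R) : measurable_fun setT
  (fun x : measurableTypeR R => b + e * x : measurableTypeR R).
Proof. by apply: measurable_funD => //; exact: measurable_funM. Qed.

(** The image of Lebesgue measure under x -> b + e x, multiplied by e, gives every interval ]x, y]
    its length, hence is Lebesgue measure by uniqueness. *)
Lemma integral_affine1 (b e : R) (f : R -> \bar R) : 0 < e ->
  measurable_fun setT f -> (forall x, 0 <= f x)%E ->
  (\int[leb]_x f (b + e * x)%R = (e^-1)%:E * \int[leb]_x f x)%E.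
Proof.
move=> e0 mf f0.
have ma := measurable_affine1 b e.
have e0' : 0 <= e by exact: ltW.
pose nu := mscale (NngNum e0')
  (measure_function_pushforward__canonical__measure_function_Measure leb ma).
have nuE A : measurable A -> leb A = nu A.
  move=> mA; apply: lebesgue_measure_unique => // X [[x y] _ <-] /=.
  rewrite /nu /mscale/= /pushforward/=.
  have -> : (fun x0 => b + e * x0) @^-1` `]x, y] = `]((x - b) / e), ((y - b) / e)]%classic.
    apply/seteqP; split => z /=; rewrite !in_itv/= ltr_pdivrMr// ler_pdivlMr// ltrBlDl lerBrDl (mulrC z)//.
  rewrite !lebesgue_measure_itv/= !lte_fin ltr_pM2r ?invr_gt0// ltrD2r.
  case: ifPn => _; last by rewrite mule0.
  by rewrite -!EFinD -EFinM; congr EFin; field; rewrite gt_eqF.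
rewrite [in RHS](eq_measure_integral nu) => [|A mA _]; last exact: nuE.
rewrite ge0_integral_mscale//= ge0_integral_pushforward//=.
by rewrite muleA -EFinM mulVf ?gt_eqF// mul1e.
Qed.

Lemma measurable_affine_rV n (b : 'rV[R]_n) (e : R) :
  measurable_fun setT (fun x : 'rV[R]_n => b + e *: x).
Proof.
apply/measurable_fun_rVP => i; under eq_fun do rewrite !mxE.
apply: measurable_funD => //; apply: measurable_funM => //.
exact: measurable_coord.
Qed.

(** Tonelli splits off one coordinate at a time: the inner integral is rescaled by induction, the
    outer one by the one-dimensional case. *)
Lemma integral_affine_rV n (b : 'rV[R]_n) (e : R) (f : 'rV[R]_n -> \bar R) :
  0 < e -> measurable_fun setT f -> (forall x, 0 <= f x)%E ->
  (\int[lebesgue_rV R n]_x f (b + e *: x)%R =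
   (e^-1 ^+ n)%:E * \int[lebesgue_rV R n]_x f x)%E.
Proof.
move=> e0; elim: n b f => [|n IH] b f mf f0.
  rewrite !integral_rV0//; last first.
    by apply: (measurableT_comp mf); exact: measurable_affine_rV.
  by rewrite expr0 mul1e [X in f X]thinmx0.
rewrite ge0_integral_rVS//; last first.
  by apply: (measurableT_comp mf); exact: measurable_affine_rV.
pose b' : 'rV[R]_n := \row_i b ord0 (lift ord0 i).
pose J a := (\int[lebesgue_rV R n]_v f (rV_cons (a, v)))%E.
have mfc : measurable_fun setT (f \o @rV_cons R n).
  by apply: (measurableT_comp mf); exact: measurable_rV_cons.
have mJ : measurable_fun (setT : set (measurableTypeR R)) J.
  by apply: (@measurable_fun_fubini_tonelli_F _ _ _ _ _ (lebesgue_rV R n)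
    (f \o @rV_cons R n)) => // x; exact: f0.
have mJ' : measurable_fun setT (fun a : measurableTypeR R => J (b ord0 ord0 + e * a)).
  by apply: (measurableT_comp mJ); exact: measurable_affine1.
have J0 a : (0 <= J a)%E by exact: integral_ge0.
have e0' : 0 <= e^-1 ^+ n by rewrite exprn_ge0// invr_ge0 ltW.
under eq_integral => a _.
  have H v : b + e *: rV_cons (a, v) = rV_cons (b ord0 ord0 + e * a, b' + e *: v).
    apply/rowP => i; rewrite !mxE; case: unliftP => [j ->|->]; by rewrite /= ?mxE.
  under eq_integral do rewrite H.
  rewrite (IH b' (fun v => f (rV_cons (b ord0 ord0 + e * a, v))))//; last first.
    by apply: (measurableT_comp mfc); exact: pair1_measurable.
  over.
rewrite ge0_integralZl//; last by move=> x _; exact: J0.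
rewrite (integral_affine1 _ e0 mJ J0) muleA -EFinM -exprSr.
by rewrite ge0_integral_rVS.
Qed.

Lemma Rintegral_affine_rV n (b : 'rV[R]_n) (e : R) (f : 'rV[R]_n -> R) :
  0 < e -> (lebesgue_rV R n).-integrable setT (EFin \o f) ->
  \int[lebesgue_rV R n]_x f (b + e *: x) =
  e^-1 ^+ n * \int[lebesgue_rV R n]_x f x.
Proof.
move=> e0 /[dup] fi /integrableP[mf _].
rewrite /Rintegral integralE [in RHS]integralE.
pose g := EFin \o f.
have -> : ((fun x => (f (b + e *: x))%:E)^\+ = (fun x => g^\+ (b + e *: x)%R))%E
  by apply/funext => x; rewrite !funeposE.
have -> : ((fun x => (f (b + e *: x))%:E)^\- = (fun x => g^\- (b + e *: x)%R))%E
  by apply/funext => x; rewrite !funenegE.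
rewrite !integral_affine_rV//; [|exact: measurable_funeneg|exact: measurable_funepos].
have h1 := integrable_pos_fin_num measurableT fi.
have h2 := integrable_neg_fin_num measurableT fi.
rewrite -(fineK h1) -(fineK h2) -!EFinM -!EFinB /=.
by rewrite mulrBr.
Qed.

End lebesgue_rV_theory.

Lemma integrable_bounded_mul d (T : measurableType d) (R : realType)
    (mu : {measure set T -> \bar R}) (M : R) (h g : T -> R) :
  measurable_fun setT h -> (forall x, `|h x| <= M) ->
  mu.-integrable setT (EFin \o g) ->
  mu.-integrable setT (fun x => (h x * g x)%:E).
Proof.
move=> mh hM gi; have /measurable_EFinP mg := measurable_int _ gi.
apply: (@le_integrable _ _ _ _ _ measurableT _ (fun x => (M * g x)%:E)).
- by apply/measurable_EFinP; exact: measurable_funM.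
- move=> x _; rewrite !abse_EFin lee_fin !normrM ler_wpM2r//.
  exact/(le_trans (hM x))/ler_norm.
- have := integrableZl measurableT M gi.
  by apply: eq_integrable => // x _; rewrite /= EFinM.
Qed.

(** * One-dimensional integrals behind the Laplace and Cauchy kernels *)

Section kernels1.
Variable R : realType.
Local Notation leb := (@lebesgue_measure R).

(** Reflection preserves Lebesgue measure, so the integral equals its own opposite. *)
Lemma Rintegral_odd (f : R -> R) : leb.-integrable setT (EFin \o f) ->
  (forall x, f (- x) = - f x) -> \int[leb]_x f x = 0.
Proof.
move=> fi fN.
have mN : measurable_fun setT (-%R : measurableTypeR R -> measurableTypeR R).
  exact: measurable_funN.
have H : (\int[leb]_x (f x)%:E = \int[leb]_x (- (f x)%:E))%E.
  transitivity (\int[pushforward leb (-%R : _ -> measurableTypeR R)]_x (f x)%:E)%E.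
    apply: (eq_measure_integral (measure_function_pushforward__canonical__measure_function_Measure leb mN)) => A mA _.
    by rewrite [RHS]lebesgue_measureN.
  rewrite (@integral_pushforward _ _ _ _ _ _ mN)//.
  - by rewrite preimage_setT; apply: eq_integral => x _ /=; rewrite fN.
  - exact: measurable_int fi.
  - rewrite preimage_setT; have := integrableN fi.
    by apply: eq_integrable => // x _ /=; rewrite fN.
have : \int[leb]_x f x = - \int[leb]_x f x.
  rewrite {1}/Rintegral H integralN ?fineN//.
  by rewrite /= fin_num_adde_defl// fin_numN; exact: integrable_neg_fin_num.
lra.
Qed.

Let cexp (z : R) : continuous (fun t : R => expR (- t) * (1 + cos (z * t))).
Proof.
move=> t; apply: cvgM.
  by apply: continuous_comp; [exact: opp_continuous|exact: continuous_expR].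
apply: cvgD; first exact: cvg_cst.
by apply: continuous_comp; [exact: mulrl_continuous|exact: continuous_cos].
Qed.

(** Integrating exp (- t) cos (z t) by parts twice gives the second term. The constant 1 added to
    the cosine makes the integrand nonnegative, as the fundamental theorem on a half-line used below
    demands. *)
Let F (z t : R) := - expR (- t) +
  expR (- t) * ((z * sin (z * t) - cos (z * t)) / (1 + z ^+ 2)).

Let dF (z t : R) : is_derive t (1 : R) (F z) (expR (- t) * (1 + cos (z * t))).
Proof.
rewrite /F.
have z0 : 1 + z ^+ 2 != 0 by rewrite gt_eqF// ltr_pwDl// sqr_ge0.
apply: is_derive_eq.
rewrite !scaler1 /GRing.scale/=.
by field.
Qed.

Let F_cvg (z : R) : F z t @[t --> +oo] --> (0 : R).
Proof.
pose M := 1 + (`|z| + 1) * (1 + z ^+ 2)^-1.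
have z0 : 0 < 1 + z ^+ 2 by rewrite ltr_pwDl// sqr_ge0.
apply/norm_cvg0P; apply: (@squeeze_cvgr _ _ _ _ (fun=> 0) (fun t => expR (- t) * M)).
- near=> t; rewrite normr_ge0/= /F -{1}(mulr1 (expR _)) -mulrN -mulrDr normrM.
  rewrite ger0_norm ?expR_ge0// ler_pM2l ?expR_gt0//.
  rewrite /M (le_trans (ler_normD _ _))// normrN normr1 lerD2l normrM.
  rewrite (@ger0_norm _ (1 + z ^+ 2)^-1) ?invr_ge0 ?(ltW z0)// ler_wpM2r ?invr_ge0 ?(ltW z0)//.
  rewrite (le_trans (ler_normB _ _))// lerD//; last first.
    by rewrite ler_norml cos_geN1 cos_le1.
  rewrite normrM ler_piMr//.
  by rewrite ler_norml sin_geN1 sin_le1.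
- exact: cvg_cst.
- rewrite -[X in _ --> X](mul0r M); apply: cvgM; last exact: cvg_cst.
  exact: cvgr_expR.
Unshelve. all: by end_near. Qed.

Let claplace (z : R) : continuous (fun x : R => expR (- `|x|) * (1 + cos (z * x))).
Proof.
move=> t; apply: cvgM.
    apply: continuous_comp; last exact: continuous_expR.
    by apply: continuous_comp; [exact: norm_continuous|exact: opp_continuous].
  apply: cvgD; first exact: cvg_cst.
  by apply: continuous_comp; [exact: mulrl_continuous|exact: continuous_cos].
Qed.

Let ge0_integral_laplace (z : R) :
  (\int[leb]_x (expR (- `|x|) * (1 + cos (z * x)))%:E
   = (2 * (1 + (1 + z ^+ 2)^-1))%:E)%E.
Proof.
have pos (x t : R) : 0 <= expR x * (1 + cos t).
  by rewrite mulr_ge0 ?expR_ge0// -lerBlDl sub0r cos_geN1.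
rewrite (ge0_symfun_integralT _ (@claplace z))//; last first.
  by move=> x /=; rewrite normrN mulrN cosN.
rewrite EFinM -set_itvcy; congr (_ * _)%E.
transitivity (\int[leb]_(x in `[0%R, +oo[) (expR (- x) * (1 + cos (z * x)))%:E)%E.
  by apply: eq_integral => x; rewrite inE/= in_itv/= andbT => x0; rewrite ger0_norm.
rewrite (ge0_continuous_FTC2y (l := 0) (F := F z)) => //.
- rewrite /F oppr0 expR0 mulr0 sin0 cos0; congr EFin; field.
  by rewrite gt_eqF// ltr_pwDl// sqr_ge0.
- exact: continuous_subspaceT.
- apply/cvg_at_right_filter/differentiable_continuous/derivable1_diffP.
  exact: (@ex_derive _ _ _ _ _ _ _ (dF z 0)).
- by move=> x _; rewrite derive1E; exact: (@derive_val _ _ _ _ _ _ _ (dF z x)).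
Qed.

Lemma integrable_expNnorm : leb.-integrable setT (EFin \o (fun x => expR (- `|x|))).
Proof.
have mf : measurable_fun setT (fun x : R => expR (- `|x|)).
  apply: continuous_measurable_fun => t.
  apply: continuous_comp; last exact: continuous_expR.
  by apply: continuous_comp; [exact: norm_continuous|exact: opp_continuous].
apply/integrableP; split; first exact/measurable_EFinP.
(* At z = 0 the integrand computed above is twice exp (- |x|). *)
apply: (@le_lt_trans _ _ (\int[leb]_x (expR (- `|x|) * (1 + cos (0 * x)))%:E)%E).
  apply: ge0_le_integral => //.
  - exact/measurable_EFinP/measurableT_comp.
  - apply/measurable_EFinP; apply: continuous_measurable_fun; exact: claplace.
  - move=> x _; rewrite mul0r cos0 lee_fin ger0_norm ?expR_ge0//.
    by rewrite ler_peMr ?expR_ge0// lerDl.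
by rewrite ge0_integral_laplace ltry.
Qed.

Lemma integrable_expNnormM (h : R -> R) : continuous h ->
  (forall x, `|h x| <= 1) ->
  leb.-integrable setT (EFin \o (fun x => h x * expR (- `|x|))).
Proof.
move=> ch h1; have mh : measurable_fun setT h by exact: continuous_measurable_fun.
exact: (@integrable_bounded_mul _ _ R leb 1 h _ mh h1 integrable_expNnorm).
Qed.

Let ccos (z : R) : continuous (fun x : R => cos (z * x)).
Proof.
by move=> t; apply: continuous_comp; [exact: mulrl_continuous|exact: continuous_cos].
Qed.
Let csin (z : R) : continuous (fun x : R => sin (z * x)).
Proof.
by move=> t; apply: continuous_comp; [exact: mulrl_continuous|exact: continuous_sin].
Qed.

Lemma Rintegral_cos_expNnorm (z : R) :
  \int[leb]_x (cos (z * x) * expR (- `|x|)) = 2 / (1 + z ^+ 2).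
Proof.
have L y : \int[leb]_x (expR (- `|x|) * (1 + cos (y * x))) =
    2 * (1 + (1 + y ^+ 2)^-1).
  by rewrite /Rintegral ge0_integral_laplace.
have cosi y : leb.-integrable setT (EFin \o (fun x => cos (y * x) * expR (- `|x|))).
  by apply: integrable_expNnormM => // x; rewrite ler_norml cos_geN1 cos_le1.
have D y : \int[leb]_x (expR (- `|x|) * (1 + cos (y * x))) =
   \int[leb]_x expR (- `|x|) + \int[leb]_x (cos (y * x) * expR (- `|x|)).
  rewrite -RintegralD//; last exact: integrable_expNnorm.
  by apply: eq_Rintegral => x _; rewrite mulrDr mulr1 (mulrC (cos _)).
(* The case z = 0 yields the integral of exp (- |x|), namely 2, which is then subtracted from the
   case of general z. *)
have := L 0; rewrite D.
under [X in _ + X = _]eq_Rintegral do rewrite mul0r cos0 mul1r.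
have := L z; rewrite D expr0n addr0 invr1 {L D cosi}.
set A := Rintegral _ _ _; set B := Rintegral _ _ _.
by move: A B => A B; lra.
Qed.

Lemma Rintegral_sin_expNnorm (z : R) :
  \int[leb]_x (sin (z * x) * expR (- `|x|)) = 0.
Proof.
apply: Rintegral_odd => [|x]; last by rewrite mulrN sinN normrN mulNr.
by apply: integrable_expNnormM => // x; rewrite ler_norml sin_geN1 sin_le1.
Qed.

Lemma integral_oneDsqrV : (\int[leb]_x (oneDsqr x)^-1%:E = pi%:E)%E.
Proof.
rewrite ge0_symfun_integralT//=.
- rewrite -set_itvcy integral0y_oneDsqr -EFinM; by congr EFin; field.
- exact: continuous_oneDsqrV.
- by move=> x /=; rewrite /oneDsqr sqrrN.
Qed.

Lemma integrable_oneDsqrV : leb.-integrable setT (EFin \o (fun x => (oneDsqr x)^-1)).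
Proof.
apply/integrableP; split.
  apply/measurable_EFinP; apply: continuous_measurable_fun.
  exact: continuous_oneDsqrV.
under eq_integral do rewrite gee0_abs ?lee_fin ?invr_ge0//.
by rewrite integral_oneDsqrV ltry.
Qed.

End kernels1.

(** * Laplace and Cauchy kernels *)

Section swap.
Context d1 d2 (X : measurableType d1) (Y : measurableType d2) (R : realType).
Variables (m1 : {sigma_finite_measure set X -> \bar R}).
Variables (m2 : {sigma_finite_measure set Y -> \bar R}).

(** The product w(x) phi(y) is integrable on X * Y and the kernel is bounded, so Fubini applies.
    This exchange underlies both the damped inversion formula and the multiplication formula for
    Fourier transforms. *)
Lemma Rintegral_swap (k : X * Y -> R) (w : X -> R) (phi : Y -> R) (M : R) :
  measurable_fun setT k -> (forall p, `|k p| <= M) ->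
  m1.-integrable setT (EFin \o w) -> m2.-integrable setT (EFin \o phi) ->
  m1.-integrable setT (EFin \o (fun x => w x * \int[m2]_y (k (x, y) * phi y))) /\
  \int[m1]_x (w x * \int[m2]_y (k (x, y) * phi y)) =
  \int[m2]_y (phi y * \int[m1]_x (k (x, y) * w x)).
Proof.
move=> mk kM wi phii.
have /measurable_EFinP mw := measurable_int _ wi.
have /measurable_EFinP mphi := measurable_int _ phii.
pose F (p : X * Y) := (w p.1 * phi p.2 * k p)%:E.
have mw' : measurable_fun setT (fun p : X * Y => w p.1) by exact: measurableT_comp.
have mphi' : measurable_fun setT (fun p : X * Y => phi p.2) by exact: measurableT_comp.
have mF : measurable_fun setT F.
  by apply/measurable_EFinP; apply: measurable_funM => //; exact: measurable_funM.
have k1 x : measurable_fun setT (fun y => k (x, y)) by exact: measurableT_comp.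
have k2 y : measurable_fun setT (fun x => k (x, y)) by exact: measurableT_comp.
have mphiE : measurable_fun setT (fun y => `|(phi y)%:E|)%E.
  by apply: measurableT_comp => //; exact/measurable_EFinP.
have mwE : measurable_fun setT (fun x => `|(w x)%:E|)%E.
  by apply: measurableT_comp => //; exact/measurable_EFinP.
have phi0 : (0 <= \int[m2]_y `|(phi y)%:E|)%E by exact: integral_ge0.
have phioo : (\int[m2]_y `|(phi y)%:E| < +oo)%E by case/integrableP : phii.
have woo : (\int[m1]_x `|(w x)%:E| < +oo)%E by case/integrableP : wi.
have w0 : (0 <= \int[m1]_x `|(w x)%:E|)%E by exact: integral_ge0.
have Fi : (m1 \x m2)%E.-integrable setT F.
  have : (m1 \x m2)%E.-integrable setT (fun p => (w p.1 * phi p.2)%:E).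
    apply/integrable12ltyP; first by apply/measurable_EFinP; exact: measurable_funM.
    have H x : (\int[m2]_y `|(w x * phi y)%:E| =
        `|(w x)%:E| * \int[m2]_y `|(phi y)%:E|)%E.
      rewrite -ge0_integralZl//.
      by apply: eq_integral => y _; rewrite EFinM abseM.
    rewrite /=; under eq_integral do rewrite H.
    rewrite ge0_integralZr//.
    by rewrite lte_mul_pinfty// ge0_fin_numE.
  move=> /(integrable_bounded_mul mk kM).
  by apply: eq_integrable => // p _ /=; rewrite /F mulrC.
have i2 x : m2.-integrable setT (EFin \o (fun y => k (x, y) * phi y)).
  exact: (integrable_bounded_mul (k1 x) (fun y => kM (x, y)) phii).
have i1 y : m1.-integrable setT (EFin \o (fun x => k (x, y) * w x)).
  exact: (integrable_bounded_mul (k2 y) (fun x => kM (x, y)) wi).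
have FE x : (\int[m2]_y F (x, y) = (w x * \int[m2]_y (k (x, y) * phi y))%:E)%E.
  rewrite EFinM fineK; last exact: (integrable_fin_num measurableT (i2 x)).
  rewrite -integralZl//; last exact: i2.
  by apply: eq_integral => y _; rewrite /F/= -EFinM; congr EFin; ring.
split.
  have := integrable_fubini_F Fi; apply: eq_integrable => // x _.
  exact: FE.
rewrite /Rintegral; congr fine.
transitivity (\int[m1]_x \int[m2]_y F (x, y))%E.
  by apply: eq_integral => x _; rewrite FE.
rewrite Fubini//; apply: eq_integral => y _; rewrite /F/=.
rewrite EFinM fineK; last exact: (integrable_fin_num measurableT (i1 y)).
rewrite -integralZl//; last exact: i1.
by apply: eq_integral => x _; rewrite -EFinM; congr EFin; ring.
Qed.

End swap.

Section kernels.
Variable R : realType.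
Local Notation leb := (@lebesgue_measure R).
Local Notation mu n := (lebesgue_rV R n).

(** This is exp (- |x|_1). Its product form lets the transform be computed one coordinate at a
    time. *)
Definition laplace n (x : 'rV[R]_n) : R := \prod_i expR (- `|x ord0 i|).
(** Up to the factor 2^n this is the Fourier transform of [laplace]; its mass is pi^n. *)
Definition cauchy_kernel n (x : 'rV[R]_n) : R := \prod_i (oneDsqr (x ord0 i))^-1.

Lemma cauchy_kernel_gt0 n (x : 'rV[R]_n) : 0 < cauchy_kernel x.
Proof. by apply: prodr_gt0 => i _; rewrite invr_gt0 (lt_le_trans _ (oneDsqr_ge1 _)). Qed.

Lemma cauchy_kernel_le1 n (x : 'rV[R]_n) : cauchy_kernel x <= 1.
Proof.
apply: prodr_ile1 => i _; rewrite invr_ge0 invf_le1 ?oneDsqr_ge1//.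
  by rewrite (le_trans ler01 (oneDsqr_ge1 _)).
Qed.

Lemma laplace_ge0 n (x : 'rV[R]_n) : 0 <= laplace x.
Proof. by apply: prodr_ge0 => i _; exact: expR_ge0. Qed.

Lemma laplace_le1 n (x : 'rV[R]_n) : laplace x <= 1.
Proof.
by apply: prodr_ile1 => i _; rewrite expR_ge0 -expR0 ler_expR oppr_le0 normr_ge0.
Qed.

Lemma measurable_oneDsqrV : measurable_fun setT (fun x : R => (oneDsqr x)^-1).
Proof. by apply: continuous_measurable_fun; exact: continuous_oneDsqrV. Qed.

Lemma measurable_cauchy_kernel n : measurable_fun setT (@cauchy_kernel n).
Proof. by apply: (measurable_prod_rV (g := fun x => (oneDsqr x)^-1)); exact: measurable_oneDsqrV. Qed.

Lemma integrable_cauchy_kernel n : (mu n).-integrable setT (EFin \o @cauchy_kernel n).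
Proof.
apply: (integrable_prod_rV _ (g := fun x => (oneDsqr x)^-1)).
  by move=> x; rewrite invr_ge0.
exact: integrable_oneDsqrV.
Qed.

Lemma Rintegral_cauchy_kernel n : \int[mu n]_x cauchy_kernel x = pi ^+ n.
Proof.
rewrite /Rintegral (integral_prod_rV _ (g := fun x => (oneDsqr x)^-1)).
- by rewrite integral_oneDsqrV -EFin_expe.
- exact: measurable_oneDsqrV.
- by move=> x; rewrite invr_ge0.
Qed.

Lemma integrable_laplace n : (mu n).-integrable setT (EFin \o @laplace n).
Proof.
apply: (integrable_prod_rV _ (g := fun x => expR (- `|x|))).
  by move=> x; rewrite expR_ge0.
exact: integrable_expNnorm.
Qed.

Lemma dotpC n (x y : 'rV[R]_n) : dotp x y = dotp y x.
Proof. by rewrite /dotp; apply: eq_bigr => i _; rewrite mulrC. Qed.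

Lemma measurable_dotp d (T : measurableType d) n (f g : T -> 'rV[R]_n) :
  measurable_fun setT f -> measurable_fun setT g ->
  measurable_fun setT (fun t => dotp (f t) (g t)).
Proof.
move=> mf mg; apply: measurable_sum => i; apply: measurable_funM.
  exact: (measurable_fun_rVP f).1.
exact: (measurable_fun_rVP g).1.
Qed.

Lemma cos_norm_le1 (x : R) : `|cos x| <= 1.
Proof. by rewrite ler_norml cos_geN1 cos_le1. Qed.

Lemma sin_norm_le1 (x : R) : `|sin x| <= 1.
Proof. by rewrite ler_norml sin_geN1 sin_le1. Qed.

Lemma measurable_cos : measurable_fun setT (@cos R).
Proof. by apply: continuous_measurable_fun; exact: continuous_cos. Qed.

Lemma measurable_sin : measurable_fun setT (@sin R).
Proof. by apply: continuous_measurable_fun; exact: continuous_sin. Qed.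

Lemma integrable_cosM n (z : 'rV[R]_n) (g : 'rV[R]_n -> R) :
  (mu n).-integrable setT (EFin \o g) ->
  (mu n).-integrable setT (EFin \o (fun x => cos (dotp z x) * g x)).
Proof.
move=> gi; apply: (integrable_bounded_mul _ (fun=> cos_norm_le1 _) gi).
by apply: (measurableT_comp measurable_cos); exact: measurable_dotp.
Qed.

Lemma integrable_sinM n (z : 'rV[R]_n) (g : 'rV[R]_n -> R) :
  (mu n).-integrable setT (EFin \o g) ->
  (mu n).-integrable setT (EFin \o (fun x => sin (dotp z x) * g x)).
Proof.
move=> gi; apply: (integrable_bounded_mul _ (fun=> sin_norm_le1 _) gi).
by apply: (measurableT_comp measurable_sin); exact: measurable_dotp.
Qed.

Lemma Rintegral_rVS n (f : 'rV[R]_n.+1 -> R) :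
  (mu n.+1).-integrable setT (EFin \o f) ->
  (forall a, (mu n).-integrable setT (fun v => (f (rV_cons (a, v)))%:E)) ->
  \int[mu n.+1]_x f x = \int[leb]_a \int[mu n]_v f (rV_cons (a, v)).
Proof.
move=> fi fai; rewrite /Rintegral; congr fine; rewrite integral_rVS//.
apply: eq_integral => a _; rewrite fineK//.
exact: (integrable_fin_num measurableT (fai a)).
Qed.

Lemma dotp_rV_cons n (z : 'rV[R]_n.+1) a (v : 'rV[R]_n) :
  dotp z (rV_cons (a, v)) =
  z ord0 ord0 * a + dotp (\row_i z ord0 (lift ord0 i)) v.
Proof.
rewrite /dotp big_ord_recl !mxE unlift_none; congr (_ + _).
by apply: eq_bigr => i _; rewrite !mxE liftK.
Qed.

(** The addition formulas mix cosine and sine integrals, so both are treated in one induction. Every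
    term that carries a sine integral vanishes by oddness, and the product of the cosine integrals
    remains. *)
Lemma fourier_laplace n (z : 'rV[R]_n) :
  \int[mu n]_x (cos (dotp z x) * laplace x) = 2 ^+ n * cauchy_kernel z /\
  \int[mu n]_x (sin (dotp z x) * laplace x) = 0.
Proof.
elim: n z => [|n IH] z.
  have d0 x : dotp z x = 0 by rewrite /dotp big_ord0.
  rewrite /Rintegral !integral_rV0.
  - by rewrite d0 cos0 sin0 /laplace /cauchy_kernel !big_ord0 !mul1r mul0r.
  - exact: measurable_int (integrable_sinM z (integrable_laplace 0)).
  - exact: measurable_int (integrable_cosM z (integrable_laplace 0)).
set z' := \row_i z ord0 (lift ord0 i).
have [IHc IHs] := IH z'.
have lc a (v : 'rV[R]_n) : laplace (rV_cons (a, v)) = expR (- `|a|) * laplace v.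
  exact: (prod_rV_cons (fun x => expR (- `|x|))).
have ci := integrable_cosM z' (integrable_laplace n).
have si := integrable_sinM z' (integrable_laplace n).
have Zi (c : R) (f : 'rV[R]_n -> R) : (mu n).-integrable setT (EFin \o f) ->
    (mu n).-integrable setT (EFin \o (fun x => c * f x)).
  by move=> fi; exact: (integrableZl measurableT c fi).
have cE a v : cos (dotp z (rV_cons (a, v))) * laplace (rV_cons (a, v)) =
    (cos (z ord0 ord0 * a) * expR (- `|a|)) * (cos (dotp z' v) * laplace v) -
    (sin (z ord0 ord0 * a) * expR (- `|a|)) * (sin (dotp z' v) * laplace v).
  by rewrite lc dotp_rV_cons cosD; ring.
have sE a v : sin (dotp z (rV_cons (a, v))) * laplace (rV_cons (a, v)) =
    (sin (z ord0 ord0 * a) * expR (- `|a|)) * (cos (dotp z' v) * laplace v) +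
    (cos (z ord0 ord0 * a) * expR (- `|a|)) * (sin (dotp z' v) * laplace v).
  by rewrite lc dotp_rV_cons sinD; ring.
split.
- rewrite Rintegral_rVS; last 2 first.
  + exact: (integrable_cosM z (integrable_laplace n.+1)).
  + move=> a; under eq_fun do rewrite cE.
    exact: (integrableB measurableT (Zi _ _ ci) (Zi _ _ si)).
  have H a : \int[mu n]_v (cos (dotp z (rV_cons (a, v))) * laplace (rV_cons (a, v))) =
      (cos (z ord0 ord0 * a) * expR (- `|a|)) * (2 ^+ n * cauchy_kernel z').
    under eq_Rintegral do rewrite cE.
    rewrite (RintegralB measurableT (Zi _ _ ci) (Zi _ _ si)).
    by rewrite !RintegralZl// IHc IHs mulr0 subr0.
  under eq_Rintegral do rewrite H.
  rewrite RintegralZr//; last first.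
    apply: integrable_expNnormM => [|x]; last exact: cos_norm_le1.
    by move=> t; apply: continuous_comp; [exact: mulrl_continuous|exact: continuous_cos].
  rewrite Rintegral_cos_expNnorm /cauchy_kernel [in RHS]big_ord_recl.
  under [in LHS]eq_bigr do rewrite /z' mxE.
  by rewrite (exprS _ n) /oneDsqr; ring.
- rewrite Rintegral_rVS; last 2 first.
  + exact: (integrable_sinM z (integrable_laplace n.+1)).
  + move=> a; under eq_fun do rewrite sE.
    exact: (integrableD measurableT (Zi _ _ ci) (Zi _ _ si)).
  have H a : \int[mu n]_v (sin (dotp z (rV_cons (a, v))) * laplace (rV_cons (a, v))) =
      (sin (z ord0 ord0 * a) * expR (- `|a|)) * (2 ^+ n * cauchy_kernel z').
    under eq_Rintegral do rewrite sE.
    rewrite (RintegralD measurableT (Zi _ _ ci) (Zi _ _ si)).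
    by rewrite !RintegralZl// IHc IHs mulr0 addr0.
  under eq_Rintegral do rewrite H.
  rewrite RintegralZr//; last first.
    apply: integrable_expNnormM => [|x]; last exact: sin_norm_le1.
    by move=> t; apply: continuous_comp; [exact: mulrl_continuous|exact: continuous_sin].
  by rewrite Rintegral_sin_expNnorm mul0r.
Qed.

End kernels.

(** * Fourier inversion bound *)

Lemma Rintegral_dominated_cvg d (T : measurableType d) (R : realType)
    (mu : {measure set T -> \bar R}) (f_ : nat -> T -> R) (f g : T -> R) :
  (forall m, measurable_fun setT (f_ m)) ->
  (forall x, f_ m x @[m --> \oo] --> f x) ->
  mu.-integrable setT (EFin \o g) ->
  (forall m x, `|f_ m x| <= g x) ->
  mu.-integrable setT (EFin \o f) /\
  \int[mu]_x f_ m x @[m --> \oo] --> \int[mu]_x f x.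
Proof.
move=> mf_ ff gi fg.
have mf : measurable_fun setT f.
  exact: (measurable_realfun.measurable_fun_cvg mf_ (fun x _ => ff x)).
have [||||fi _ fcvg] := @dominated_convergence _ _ _ mu setT measurableT
   (fun m => EFin \o f_ m) (EFin \o f) (EFin \o g) _ _ _ gi.
- by move=> m; exact/measurable_EFinP.
- exact/measurable_EFinP.
- by apply: aeW => x _; apply: cvg_EFin; [exact: nearW|exact: ff].
- by apply: aeW => x m _; rewrite lee_fin.
split=> //.
have fifin := integrable_fin_num measurableT fi.
rewrite /Rintegral; apply: fine_cvg; rewrite fineK//.
Qed.

Lemma harmonic_gt0 (R : realType) (m : nat) : 0 < m.+1%:R^-1 :> R.
Proof. by rewrite invr_gt0 ltr0n. Qed.

Section inversion_bound.
Variables (R : realType) (n : nat).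
Local Notation mu := (lebesgue_rV R n).
Variables (a b : 'rV[R]_n -> R) (M : R).
Hypotheses (ca : continuous a) (aM : forall x, `|a x| <= M).
Hypotheses (ai : mu.-integrable setT (EFin \o a)).
Hypotheses (bi : mu.-integrable setT (EFin \o b)).

Variables A B : 'rV[R]_n -> R.
Hypothesis AE : forall xi,
  A xi = \int[mu]_x (cos (dotp x xi) * a x + sin (dotp x xi) * b x).
Hypothesis BE : forall xi,
  B xi = \int[mu]_x (cos (dotp x xi) * b x - sin (dotp x xi) * a x).
Hypotheses (Ai : mu.-integrable setT (EFin \o A)).
Hypotheses (Bi : mu.-integrable setT (EFin \o B)).

Let dotpBl (x y z : 'rV[R]_n) : dotp (x - y) z = dotp x z - dotp y z.
Proof.
rewrite /dotp raddf_sum -big_split; apply: eq_bigr => i _ /=.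
by rewrite !mxE mulrBl.
Qed.
Let dotpZl c (y z : 'rV[R]_n) : dotp (c *: y) z = c * dotp y z.
Proof. by rewrite /dotp mulr_sumr; apply: eq_bigr => i _ /=; rewrite mxE mulrA. Qed.

Let cosi (z : 'rV[R]_n) (g : 'rV[R]_n -> R) :
  mu.-integrable setT (EFin \o g) ->
  mu.-integrable setT (EFin \o (fun x => cos (dotp x z) * g x)).
Proof. by move=> gi; under eq_fun do rewrite dotpC; exact: integrable_cosM. Qed.
Let sini (z : 'rV[R]_n) (g : 'rV[R]_n -> R) :
  mu.-integrable setT (EFin \o g) ->
  mu.-integrable setT (EFin \o (fun x => sin (dotp x z) * g x)).
Proof. by move=> gi; under eq_fun do rewrite dotpC; exact: integrable_sinM. Qed.

(** The left side is the real part of exp (i x0.xi) (A + i B)(xi), where A + i B is the transform of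
    a + i b: it is the integrand of the inversion formula for a at x0. *)
Let rotate x0 xi : cos (dotp x0 xi) * A xi - sin (dotp x0 xi) * B xi =
  \int[mu]_x (cos (dotp (x - x0) xi) * a x) +
  \int[mu]_x (sin (dotp (x - x0) xi) * b x).
Proof.
rewrite AE BE RintegralD ?RintegralB//; try exact: cosi; try exact: sini.
under [X in _ = X + _]eq_Rintegral => x _.
  rewrite dotpBl cosB (_ : _ * a x = cos (dotp x0 xi) * (cos (dotp x xi) * a x) +
    sin (dotp x0 xi) * (sin (dotp x xi) * a x)); last by ring.
  over.
under [X in _ = _ + X]eq_Rintegral => x _.
  rewrite dotpBl sinB (_ : _ * b x = cos (dotp x0 xi) * (sin (dotp x xi) * b x) -
    sin (dotp x0 xi) * (cos (dotp x xi) * b x)); last by ring.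
  over.
have Zi (c : R) (f : 'rV[R]_n -> R) : mu.-integrable setT (EFin \o f) ->
    mu.-integrable setT (EFin \o (fun x => c * f x)).
  by move=> fi; exact: (integrableZl measurableT c fi).
have h1 := cosi xi ai; have h2 := sini xi ai.
have h3 := cosi xi bi; have h4 := sini xi bi.
rewrite RintegralD//; [|exact: Zi..].
rewrite RintegralB//; [|exact: Zi..].
rewrite !RintegralZl//.
ring.
Qed.

Let theta e (xi : 'rV[R]_n) := laplace (e *: xi).

Let thetai e : 0 < e -> mu.-integrable setT (EFin \o theta e).
Proof.
move=> e0; have mth : measurable_fun setT (fun x : 'rV[R]_n => laplace (0 + e *: x)).
  apply: (measurableT_comp _ (measurable_affine_rV 0 e)).
  by have /measurable_EFinP := measurable_int _ (integrable_laplace R n).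
apply/integrableP; split.
  by apply/measurable_EFinP; move: mth; under eq_fun do rewrite add0r.
under eq_integral do rewrite gee0_abs ?lee_fin ?laplace_ge0//.
have -> : (\int[mu]_x (theta e x)%:E = \int[mu]_x (laplace (0 + e *: x)%R)%:E)%E.
  by apply: eq_integral => x _; rewrite add0r.
have /integrableP[ml loo] := integrable_laplace R n.
rewrite (integral_affine_rV 0 (f := EFin \o @laplace R n))//; last first.
  by move=> x; rewrite lee_fin laplace_ge0.
rewrite lte_mul_pinfty// ?lee_fin ?exprn_ge0 ?invr_ge0 ?(ltW e0)//.
move: loo; apply: le_lt_trans; apply: ge0_le_integral => //.
- by move=> x _; rewrite lee_fin laplace_ge0.
- exact: measurableT_comp.
- by move=> x _; rewrite lee_fin ler_norm.
Qed.

Let fourier_theta e z : 0 < e ->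
  \int[mu]_xi (cos (dotp z xi) * theta e xi) =
    e^-1 ^+ n * (2 ^+ n * cauchy_kernel (e^-1 *: z)) /\
  \int[mu]_xi (sin (dotp z xi) * theta e xi) = 0.
Proof.
move=> e0; have [cE sE] := fourier_laplace (e^-1 *: z).
have H xi : dotp z xi = dotp (e^-1 *: z) (0 + e *: xi).
  by rewrite add0r dotpZl (dotpC z (e *: xi)) dotpZl mulrA mulVf ?mul1r 1?dotpC// gt_eqF.
have li := integrable_laplace R n.
split.
- rewrite -cE -(Rintegral_affine_rV 0 e0 (integrable_cosM _ li)).
  by apply: eq_Rintegral => xi _; rewrite H /theta add0r.
- rewrite -[RHS](mulr0 (e^-1 ^+ n)) -sE -(Rintegral_affine_rV 0 e0 (integrable_sinM _ li)).
  by apply: eq_Rintegral => xi _; rewrite H /theta add0r.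
Qed.

Let ma : measurable_fun setT a.
Proof. exact: continuous_measurable_rV. Qed.

(** The right side is the damped inversion integral. Exchanging the integrals puts the transform of
    [theta e] under the integral over x: its sine part is 0, which removes b, and its cosine part is
    a rescaled Cauchy kernel. The substitution x = x0 + e v then absorbs the factor e^-n. *)
Let mollify e x0 : 0 < e ->
  \int[mu]_v (a (x0 + e *: v) * (2 ^+ n * cauchy_kernel v)) =
  \int[mu]_xi (theta e xi * (cos (dotp x0 xi) * A xi - sin (dotp x0 xi) * B xi)).
Proof.
move=> e0.
have msub : measurable_fun setT (fun p : 'rV[R]_n * 'rV[R]_n => p.2 - x0).
  have := measurable_affine_rV (- x0) 1.
  under eq_fun do rewrite scale1r addrC.
  by move=> h; exact: (measurableT_comp h).
have mdot : measurable_fun setT (fun p : 'rV[R]_n * 'rV[R]_n => dotp (p.2 - x0) p.1).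
  exact: measurable_dotp.
have mc : measurable_fun setT (fun p : 'rV[R]_n * 'rV[R]_n => cos (dotp (p.2 - x0) p.1)).
  exact: (measurableT_comp (@measurable_cos R)).
have ms : measurable_fun setT (fun p : 'rV[R]_n * 'rV[R]_n => sin (dotp (p.2 - x0) p.1)).
  exact: (measurableT_comp (@measurable_sin R)).
have [csi cs] := Rintegral_swap mc (fun=> cos_norm_le1 _) (thetai e0) ai.
have [ssi ss] := Rintegral_swap ms (fun=> sin_norm_le1 _) (thetai e0) bi.
rewrite /= in csi cs ssi ss.
under [RHS]eq_Rintegral do rewrite rotate mulrDr.
rewrite (RintegralD measurableT csi ssi) cs ss {csi ssi cs ss}.
rewrite [X in _ = _ + X](_ : _ = 0) ?addr0; last first.
  under eq_Rintegral do rewrite (fourier_theta _ e0).2 mulr0.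
  by rewrite Rintegral_cst// mul0r.
under [RHS]eq_Rintegral do rewrite (fourier_theta _ e0).1.
have en : e^-1 ^+ n != 0 by rewrite expf_neq0// invr_eq0 gt_eqF.
pose F x := a x * (2 ^+ n * cauchy_kernel (e^-1 *: (x - x0))).
have mk : measurable_fun setT (fun x : 'rV[R]_n => 2 ^+ n * cauchy_kernel (e^-1 *: (x - x0))).
  apply: measurable_funM => //; apply: (measurableT_comp (@measurable_cauchy_kernel R n)).
  have := measurable_affine_rV (- (e^-1 *: x0)) e^-1.
  by under eq_fun do rewrite addrC -scalerBr.
have Fi : mu.-integrable setT (EFin \o F).
  have : mu.-integrable setT (fun x : 'rV[R]_n => (2 ^+ n * cauchy_kernel (e^-1 *: (x - x0)) * a x)%:E).
    apply: (@integrable_bounded_mul _ _ _ _ (2 ^+ n) _ _ mk _ ai) => x.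
    rewrite ger0_norm; last by rewrite mulr_ge0 ?exprn_ge0// (ltW (cauchy_kernel_gt0 _)).
    by rewrite ler_piMr ?exprn_ge0// cauchy_kernel_le1.
  by apply: eq_integrable => // x _; rewrite /F/= mulrC.
transitivity (\int[mu]_v F (x0 + e *: v)).
  apply: eq_Rintegral => v _; rewrite /F [x0 + _]addrC addrK.
  by rewrite scalerA mulVf ?gt_eqF// scale1r.
rewrite Rintegral_affine_rV// -RintegralZl//.
by apply: eq_Rintegral => x _; rewrite /F; ring.
Qed.

Let N xi := `|A xi| + `|B xi|.

Let Ni : mu.-integrable setT (EFin \o N).
Proof.
have := integrableD measurableT (integrable_abse Ai) (integrable_abse Bi).
by [].
Qed.

Let mollify_le e x0 : 0 < e ->
  `|\int[mu]_v (a (x0 + e *: v) * (2 ^+ n * cauchy_kernel v))| <= \int[mu]_xi N xi.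
Proof.
move=> e0; rewrite mollify//.
pose G xi := theta e xi * (cos (dotp x0 xi) * A xi - sin (dotp x0 xi) * B xi).
have GN xi : `|G xi| <= N xi.
  rewrite /G normrM.
  apply: (@le_trans _ _ `|cos (dotp x0 xi) * A xi - sin (dotp x0 xi) * B xi|).
    apply: ler_piMl => //.
    by rewrite ger0_norm ?laplace_ge0 ?laplace_le1.
  apply: (le_trans (ler_normB _ _)); rewrite !normrM; apply: lerD;
    apply: ler_piMl => //; [exact: cos_norm_le1|exact: sin_norm_le1].
have /measurable_EFinP mth := measurable_int _ (thetai e0).
have /measurable_EFinP mA := measurable_int _ Ai.
have /measurable_EFinP mB := measurable_int _ Bi.
have mG : measurable_fun setT G.
  have md : measurable_fun setT (fun xi : 'rV[R]_n => dotp x0 xi) by exact: measurable_dotp.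
  apply: measurable_funM => //; apply: measurable_funB; apply: measurable_funM => //.
    exact: (measurableT_comp (@measurable_cos R)).
  exact: (measurableT_comp (@measurable_sin R)).
have Gi : mu.-integrable setT (EFin \o G).
  apply: (le_integrable measurableT _ _ Ni); first exact/measurable_EFinP.
  by move=> xi _; rewrite lee_fin (le_trans (GN _))// ler_norm.
rewrite (le_trans (le_normr_Rintegral measurableT Gi))//.
apply: le_Rintegral => //; exact: integrable_abse Gi.
Qed.

(** As e tends to 0 the mollified values converge to a(x0) times the mass (2 pi)^n of 2^n
    [cauchy_kernel], by continuity and boundedness of a. Their bound by the integral of [N] does not
    depend on e, so only an inequality has to pass to the limit. *)
Lemma fourier_inversion_bound x0 :
  `|a x0| <= (2 ^+ n * pi ^+ n)^-1 * \int[mu]_xi N xi.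
Proof.
pose f_ m v := a (x0 + m.+1%:R^-1 *: v) * (2 ^+ n * cauchy_kernel v).
have [|||mm|fi fcvg] := @Rintegral_dominated_cvg _ _ R mu f_
   (fun v => a x0 * (2 ^+ n * cauchy_kernel v))
   (fun v => M * (2 ^+ n * cauchy_kernel v)).
- move=> m; apply: measurable_funM.
    exact: (measurableT_comp ma (measurable_affine_rV x0 m.+1%:R^-1)).
  by apply: measurable_funM => //; exact: measurable_cauchy_kernel.
- move=> v; apply: cvgM; last exact: cvg_cst.
  apply: (@cvg_comp _ _ _ (fun m => x0 + m.+1%:R^-1 *: v) a _ (nbhs x0)); last exact: ca.
  have : (fun m => x0 + m.+1%:R^-1 *: v) @ \oo --> x0 + 0 *: v.
    by apply: cvgD; [exact: cvg_cst|apply: cvgZr_tmp; exact: cvg_harmonic].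
  by rewrite scale0r addr0.
- have := integrableZl measurableT (M * 2 ^+ n) (integrable_cauchy_kernel R n).
  by apply: eq_integrable => // v _; rewrite /= -EFinM mulrA.
- move=> v; rewrite normrM ler_pM// ger0_norm// mulr_ge0 ?exprn_ge0// ltW//.
  exact: cauchy_kernel_gt0.
have p0 : 0 < 2 ^+ n * pi ^+ n :> R by rewrite mulr_gt0 ?exprn_gt0// pi_gt0.
rewrite -ler_pdivrMl ?invr_gt0// invrK.
have : \int[mu]_v (a x0 * (2 ^+ n * cauchy_kernel v)) = a x0 * (2 ^+ n * pi ^+ n).
  rewrite -Rintegral_cauchy_kernel -RintegralZl//; last exact: integrable_cauchy_kernel.
  rewrite -RintegralZl//.
  have := integrableZl measurableT (2 ^+ n) (integrable_cauchy_kernel R n).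
  by apply: eq_integrable.
move=> E; rewrite E in fcvg.
rewrite -(gtr0_norm p0) mulrC -normrM.
apply: (cvgr_to_le (cvg_norm fcvg)); apply: nearW => m.
exact: (mollify_le x0 (harmonic_gt0 R m)).
Qed.

End inversion_bound.

(** * Smooth cut-offs *)

Section test_functions.
Variables (R : realType) (n : nat).
Local Notation Rn := 'rV[R]_n.
Local Notation e_ := (@delta_mx R 1 n ord0).

(** Reduces a directional derivative to the one-variable rules, which [is_derive_eq] can then
    apply. *)
Lemma is_derive_line (f : Rn -> R) (x v : Rn) (d : R) :
  is_derive (0 : R) (1 : R) (fun h : R => f (h *: v + x)) d -> is_derive x v f d.
Proof.
move=> [dv dE]; apply: DeriveDef; first exact: (derivable1P f x v).2 dv.
rewrite -dE /derive; set g1 := fun h => h^-1 *: _; set g2 := fun h => h^-1 *: _.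
suff -> : g1 = g2 by [].
rewrite /g1 /g2; by rewrite funeqE => h /=; rewrite addr0 scale0r add0r [_%:A]mulr1.
Qed.

Lemma dotp_ge0 (x : Rn) : 0 <= dotp x x.
Proof. by apply: sumr_ge0 => i _; rewrite -expr2 sqr_ge0. Qed.

Lemma japanese_sqr (x : Rn) : japanese x ^+ 2 = 1 + dotp x x.
Proof. by rewrite sqr_sqrtr// addr_ge0// dotp_ge0. Qed.

Lemma japanese_ge1 (x : Rn) : 1 <= japanese x.
Proof. by rewrite -[X in X <= _]sqrtr1 ler_wsqrtr// lerDl dotp_ge0. Qed.

Lemma japanese_gt0 (x : Rn) : 0 < japanese x.
Proof. exact: (lt_le_trans ltr01 (japanese_ge1 x)). Qed.

Lemma coord_le_japanese (x : Rn) i : `|x ord0 i| <= japanese x.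
Proof.
rewrite -sqrtr_sqr ler_wsqrtr// /dotp (bigD1 i)//= expr2 addrCA lerDl.
by rewrite addr_ge0// sumr_ge0// => j _; rewrite -expr2 sqr_ge0.
Qed.

(* The factors [exp (- exp (q_i - p x_i))] are cut-offs approximating the
   indicators of half-lines. *)
Definition cutoff_expo (p : R) (q b : Rn) (x : Rn) : R :=
  \sum_i (- x ord0 i ^+ 2 + b ord0 i * x ord0 i - expR (q ord0 i - p * x ord0 i)).

Definition cutoff_gauss (p : R) (q b : Rn) (x : Rn) : R :=
  expR (cutoff_expo p q b x).

(** A class stable under partial derivatives, with p and q fixed. The parameter b must vary:
    differentiating exp (q_i - p x_i) produces a factor exp (- p x_i), which is absorbed by
    replacing b with b - p e_i. Smoothness and decay of all derivatives then follow by induction. *)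
Inductive test_fun (p : R) (q : Rn) : (Rn -> R) -> Prop :=
| test_gauss b : test_fun p q (cutoff_gauss p q b)
| test_coord i f : test_fun p q f -> test_fun p q (fun x => x ord0 i * f x)
| test_scale c f : test_fun p q f -> test_fun p q (fun x => c * f x)
| test_add f g : test_fun p q f -> test_fun p q g ->
    test_fun p q (fun x => f x + g x).

Let line_coord (h : R) i j (x : Rn) :
  (h *: e_ i + x) ord0 j = (i == j)%:R * h + x ord0 j.
Proof. by rewrite !mxE eqxx /= eq_sym mulrC. Qed.

Let is_derive_coord i j (x : Rn) :
  is_derive x (e_ i) (fun y : Rn => y ord0 j) ((i == j)%:R : R).
Proof.
apply: is_derive_line.
under eq_fun do rewrite line_coord.
by apply: is_derive_eq; rewrite addr0 [_%:A]mulr1.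
Qed.

Let is_derive_gauss p q b i (x : Rn) :
  is_derive x (e_ i) (cutoff_gauss p q b)
    (-2 * (x ord0 i * cutoff_gauss p q b x) +
     (b ord0 i * cutoff_gauss p q b x +
     p * expR (q ord0 i) * cutoff_gauss p q (b - p *: e_ i) x)).
Proof.
apply: is_derive_line.
pose S := \sum_(j | j != i)
  (- x ord0 j ^+ 2 + b ord0 j * x ord0 j - expR (q ord0 j - p * x ord0 j)).
have E h : cutoff_expo p q b (h *: e_ i + x) =
    - (h + x ord0 i) ^+ 2 + b ord0 i * (h + x ord0 i)
    - expR (q ord0 i - p * (h + x ord0 i)) + S.
  rewrite /cutoff_expo (bigD1 i) //; congr (_ + _).
    by rewrite line_coord eqxx mul1r.
  apply: eq_bigr => j ji; rewrite line_coord.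
  by rewrite eq_sym (negbTE ji) mul0r add0r.
have E0 : cutoff_expo p q b x = - x ord0 i ^+ 2 + b ord0 i * x ord0 i
    - expR (q ord0 i - p * x ord0 i) + S.
  by have := E 0; rewrite scale0r !add0r.
(* Shifting b by - p e_i multiplies the cut-off by exp (- p x_i), the factor created by the chain
   rule. *)
have E1 : cutoff_expo p q (b - p *: e_ i) x =
    cutoff_expo p q b x - p * x ord0 i.
  rewrite E0 /cutoff_expo (bigD1 i) //.
  have -> : \sum_(j | j != i) (- x ord0 j ^+ 2 + (b - p *: e_ i) ord0 j * x ord0 j
      - expR (q ord0 j - p * x ord0 j)) = S.
    apply: eq_bigr => j ji.
    by rewrite !mxE eqxx (negbTE ji) mulr0 subr0.
  by rewrite !mxE !eqxx andbT mulr1 /=; move: (expR _) => e; ring.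
rewrite /cutoff_gauss E1 E0; under eq_fun do rewrite E.
clearbody S; clear E E0 E1.
apply: is_derive_eq.
rewrite !(add0r, addr0) /GRing.scale/=.
set T := _ + S; rewrite (expRD T) (expRD (q ord0 i)).
move: (expR T) (expR (q _ _)) (expR (- _)) => *; ring.
Qed.

Let test_derive p q f i : test_fun p q f ->
  exists2 g, test_fun p q g & forall x, is_derive x (e_ i) f (g x).
Proof.
elim=> {f} [b|j f tf [g tg fg]|c f tf [g tg fg]|f1 f2 _ [g1 tg1 fg1] _ [g2 tg2 fg2]].
- eexists; last by move=> x; exact: is_derive_gauss.
  apply: test_add; first by apply/test_scale/test_coord/test_gauss.
  by apply: test_add; apply/test_scale/test_gauss.
- exists (fun x : Rn => x ord0 j * g x + (i == j)%:R * f x).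
    by apply: test_add; [exact: test_coord|exact: test_scale].
  move=> x; have := is_derive_coord i j x => d.
  by apply: is_derive_eq; rewrite /GRing.scale/= (mulrC (f x)).
- exists (fun x => c * g x); first exact: test_scale.
  by move=> x; exact: is_deriveZ.
- exists (fun x => g1 x + g2 x); first exact: test_add.
  by move=> x; exact: is_deriveD.
Qed.

Let cutoff_term_continuous (p q b : R) :
  continuous (fun t : R => - t ^+ 2 + b * t - expR (q - p * t)).
Proof.
move=> t; apply: cvgB.
  apply: cvgD; first by apply: cvgN; apply: cvgM; exact: cvg_id.
  by apply: cvgM; [exact: cvg_cst|exact: cvg_id].
apply: (@continuous_comp _ _ _ (fun t => q - p * t) expR); last exact: continuous_expR.
by apply: cvgB; [exact: cvg_cst|apply: cvgM; [exact: cvg_cst|exact: cvg_id]].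
Qed.

Lemma test_fun_continuous p q f : test_fun p q f -> continuous f.
Proof.
elim=> {f} [b|j f tf cf|c f tf cf|f1 f2 _ cf1 _ cf2] x.
- apply: continuous_comp; last exact: continuous_expR.
  rewrite /cutoff_expo; apply: (@continuous_big R 'I_n +%R 0 predT add_continuous Rn (index_enum 'I_n)).
  move=> i _ {}x; apply: (@continuous_comp _ _ _ (fun y : Rn => y ord0 i)
    (fun t => - t ^+ 2 + b ord0 i * t - expR (q ord0 i - p * t))).
    exact: coord_continuous.
  exact: cutoff_term_continuous.
- by apply: (continuousM _ (cf x)); exact: coord_continuous.
- by apply: (continuousM _ (cf x)); exact: cst_continuous.
- by apply: (continuousD (cf1 x)); exact: cf2.
Qed.

(** With d = |x|^2 and y = (1 + d) / (2 (N + 1)), the inequality y <= exp y raised to the power N +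
    1 gives (1 + d)^(N + 1) <= C exp (d / 2). The exponent N + 1 keeps the denominator nonzero when
    N = 0. *)
Lemma expR_dotp_decay N : exists C : R, forall x : Rn,
  japanese x ^+ N * expR (- (dotp x x) / 2) <= C.
Proof.
pose N' : R := N.+1%:R.
have N0 : 0 < N' by rewrite ltr0n.
exists (expR (1/2) * (2 * N') ^+ N.+1) => x.
set d := dotp x x.
have d0 : 0 <= d := dotp_ge0 x.
have J : japanese x ^+ N <= (1 + d) ^+ N.+1.
  rewrite -japanese_sqr -exprM ler_weXn2l ?japanese_ge1//.
  by rewrite mul2n -addnn (leq_trans (leqnSn N))// leq_addr.
have E : ((1 + d) / (2 * N')) ^+ N.+1 <= expR (1 / 2) * expR (d / 2).
  rewrite -expRD (_ : 1 / 2 + d / 2 = N' * ((1 + d) / (2 * N'))); last first.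
    by field; rewrite gt_eqF.
  have y0 : 0 <= (1 + d) / (2 * N') by rewrite divr_ge0 ?addr_ge0 ?mulr_ge0 ?(ltW N0).
  rewrite expRM_natl; apply: lerXn2r; rewrite ?nnegrE ?expR_ge0//.
  by apply: le_trans (expR_ge1Dx _); rewrite lerDr.
have -> : - d / 2 = - (d / 2) by rewrite mulNr.
rewrite expRN ler_pdivrMr ?expR_gt0//.
apply: (le_trans J); move: E; rewrite expr_div_n ler_pdivrMr; last first.
  by rewrite exprn_gt0// mulr_gt0.
by move=> /le_trans; apply; rewrite mulrAC.
Qed.

(** Drop the double exponential and use b x <= b^2 / 2 + x^2 / 2 in each coordinate. *)
Lemma cutoff_gauss_le p q b (x : Rn) :
  cutoff_gauss p q b x <= expR (dotp b b / 2) * expR (- (dotp x x) / 2).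
Proof.
rewrite -expRD ler_expR /cutoff_expo /dotp -mulrDl -sumrN -big_split/= mulr_suml.
apply: ler_sum => i _; have := expR_ge0 (q ord0 i - p * x ord0 i).
have : 0 <= (b ord0 i - x ord0 i) ^+ 2 by exact: sqr_ge0.
by move: (expR _) => E; lra.
Qed.

Let test_decay p q f : test_fun p q f -> forall N, exists C : R,
  forall x, japanese x ^+ N * `|f x| <= C.
Proof.
elim=> {f} [b|j f tf df|c f tf df|f1 f2 _ df1 _ df2] N.
- have [C HC] := expR_dotp_decay N; exists (expR (dotp b b / 2) * C) => x.
  rewrite ger0_norm ?expR_ge0//.
  apply: (@le_trans _ _ (expR (dotp b b / 2) * (japanese x ^+ N * expR (- dotp x x / 2)))).
    rewrite mulrCA ler_wpM2l ?exprn_ge0 ?(ltW (japanese_gt0 x))//.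
    exact: cutoff_gauss_le.
  by rewrite ler_wpM2l ?expR_ge0.
- have [C HC] := df N.+1; exists C => x; apply: le_trans (HC x).
  rewrite normrM exprSr -mulrA ler_wpM2l ?exprn_ge0 ?(ltW (japanese_gt0 x))//.
  by rewrite ler_wpM2r// coord_le_japanese.
- have [C HC] := df N; exists (`|c| * C) => x.
  by rewrite normrM mulrCA ler_wpM2l.
- have [C1 HC1] := df1 N; have [C2 HC2] := df2 N; exists (C1 + C2) => x.
  apply: le_trans (lerD (HC1 x) (HC2 x)).
  rewrite -mulrDr ler_wpM2l ?exprn_ge0 ?(ltW (japanese_gt0 x))//.
  exact: ler_normD.
Qed.

Let test_partials p q f l : test_fun p q f -> test_fun p q (partials l f).
Proof.
move=> tf; elim: l => //= i l IH; have [g tg Hg] := test_derive i IH.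
by rewrite (_ : (fun x => _) = g)//; apply/funext => x; exact: derive_val.
Qed.

Lemma test_fun_schwartz p q f : test_fun p q f -> real_schwartz f.
Proof.
move=> tf; split=> [l|l N]; last exact: test_decay (test_partials l tf) N.
split; first exact: test_fun_continuous (test_partials l tf).
move=> i x; have [g tg Hg] := test_derive i (test_partials l tf).
exact: (@ex_derive _ _ _ _ _ _ _ (Hg x)).
Qed.

Lemma real_schwartz0 : real_schwartz (fun _ : Rn => 0 : R).
Proof.
have H l : partials l (fun _ : Rn => 0 : R) = fun=> 0.
  by elim: l => //= i l ->; apply/funext => x; exact: derive_cst.
split=> [l|l N].
  rewrite H; split=> [x|i x]; first exact: cst_continuous.
  exact: derivable_cst.
by exists 0 => x; rewrite H normr0 mulr0.
Qed.

End test_functions.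

(** * Uniqueness of Fourier transforms *)

Section orthants.
Variables (R : realType) (n : nat).
Local Notation Rn := 'rV[R]_n.

Definition orthant (a : Rn) : set Rn := [set x | forall i, a ord0 i < x ord0 i].
Definition orthants : set (set Rn) := range orthant.

Lemma setI_closed_orthants : setI_closed orthants.
Proof.
move=> _ _ [a _ <-] [b _ <-]; exists (\row_i Num.max (a ord0 i) (b ord0 i)) => //.
apply/seteqP; split => [x /= abx|x /= [ax bx] i].
  by split=> i; have := abx i; rewrite mxE gt_max => /andP[].
by rewrite mxE gt_max ax bx.
Qed.

Lemma measurable_orthant a : measurable (orthant a).
Proof.
have -> : orthant a = \bigcap_(i in [set: 'I_n])
    ((fun x : Rn => x ord0 i) @^-1` `]a ord0 i, +oo[).
  apply/seteqP; split => x /= ax i; first by move=> _ /=; rewrite in_itv/= ax.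
  by have /= := ax i I; rewrite in_itv/= andbT.
apply: fin_bigcap_measurable => [|i _]; first exact: finite_finset.
rewrite -[X in measurable X]setTI.
by apply: measurable_coord => //; exact: measurable_itv.
Qed.

(** The sigma-algebra of R^n is the smallest that makes coordinates measurable, so it suffices to
    obtain the half-spaces x_i > c. *)
Lemma orthants_generate (A : set Rn) : measurable A -> <<s orthants >> A.
Proof.
move=> mA.
have : measurable_fun setT (idfun : g_sigma_algebraType orthants -> Rn).
  apply/measurable_fun_rVP => i.
  apply: (@measurability _ _ (g_sigma_algebraType orthants) (measurableTypeR R) _ _ _ (RGenOInfty.measurableE R)) => _ [_ [c ->] <-].
  rewrite setTI.
  (* A half-space is a countable union of orthants whose other bounds go to - oo; an integer larger
     than the sum of the |x_j| picks one that contains x. *)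
  have -> : (fun x : g_sigma_algebraType orthants => idfun x ord0 i) @^-1` `]c, +oo[ =
      \bigcup_m orthant (\row_j if j == i then c else - m%:R).
    apply/seteqP; split => x /=.
      rewrite in_itv/= andbT => cx.
      exists (Num.truncn (\sum_j `|x ord0 j|)).+1 => // j.
      rewrite mxE; case: eqP => [->//|_].
      rewrite ltrNl (le_lt_trans (ler_norm _))// normrN.
      apply: le_lt_trans (truncnS_gt _).
      by rewrite (bigD1 j)//= lerDl sumr_ge0.
    by case=> m _ /(_ i); rewrite mxE eqxx in_itv/= andbT.
  by apply: bigcupT_measurable => m; apply: sub_sigma_algebra; eexists.
by move=> /(_ measurableT A mA); rewrite setTI.
Qed.

End orthants.

Section uniqueness.
Variables (R : realType) (n : nat).
Local Notation Rn := 'rV[R]_n.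
Local Notation mu := (lebesgue_rV R n).

Definition gauss (x : Rn) : R := expR (- dotp x x).

Lemma cutoff_gauss_le_gauss p q (x : Rn) : cutoff_gauss p q 0 x <= gauss x.
Proof.
rewrite ler_expR /cutoff_expo /dotp -sumrN; apply: ler_sum => i _.
by rewrite mxE mul0r addr0 -expr2 lerBlDr lerDl expR_ge0.
Qed.

(* The exponents are arranged so that the cut-off tends to 0 on the boundary
   of the orthant as well. *)
Let phi (a : Rn) m := cutoff_gauss (m.+1%:R ^+ 2)
  (\row_i (m.+1%:R ^+ 2 * a ord0 i + m.+1%:R)) (0 : Rn).

Let expRN_le_inv (y : R) : 0 < y -> expR (- y) <= y^-1.
Proof.
move=> y0; rewrite expRN lef_pV2 ?posrE ?expR_gt0//.
by apply: le_trans (expR_ge1Dx y); rewrite lerDr.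
Qed.

Let phiE a m x : phi a m x = gauss x * expR (- \sum_i
  expR (m.+1%:R - m.+1%:R ^+ 2 * (x ord0 i - a ord0 i))).
Proof.
rewrite -expRD -opprD /dotp -big_split -sumrN; apply: (f_equal expR).
apply: eq_bigr => i _; rewrite !mxE mul0r addr0 opprD expr2; congr (_ - expR _).
by rewrite /=; ring.
Qed.

(** With k = m.+1 the inner exponent is k - k^2 (x_i - a_i). It tends to - oo if x_i > a_i, and is
    at least k otherwise, so a single bad coordinate sends the whole product to 0. *)
Let phi_cvg a x : phi a m x @[m --> \oo] --> gauss x * \1_(orthant a) x.
Proof.
under eq_cvg do rewrite phiE; apply: cvgM; first exact: cvg_cst.
rewrite indicE; case: (boolP (x \in orthant a)) => [/set_mem ax|/negP nax] /=.
- rewrite (_ : 1%:R = expR (- \sum_(i < n) 0)); last first.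
    by rewrite big1// oppr0 expR0.
  apply: (@cvg_comp _ _ _ _ expR _ _ _ _ (@continuous_expR R _)).
  apply: cvgN; apply: cvg_big => [|i _]; first exact: add_continuous.
  have d0 : 0 < x ord0 i - a ord0 i by rewrite subr_gt0.
  apply: (@squeeze_cvgr _ _ _ _ (fun=> 0) harmonic); last exact: cvg_harmonic.
    near=> m; rewrite expR_ge0/=.
    apply: le_trans (expRN_le_inv _); last by rewrite ltr0n.
    rewrite ler_expR.
    (* Once k (x_i - a_i) >= 2, the inner exponent is at most - k, and exp (- k) <= 1 / k. *)
    have : 2 / (x ord0 i - a ord0 i) <= m.+1%:R.
      apply: (@le_trans _ _ m%:R); last by rewrite ler_nat.
      by near: m; exact: nbhs_infty_ger.
    rewrite ler_pdivrMr// -subr_ge0 => kd.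
    have := mulr_ge0 (ler0n R m.+1) kd.
    by move: (m.+1%:R : R) (x ord0 i - a ord0 i) => k d; lra.
  exact: cvg_cst.
- have [i xa] : exists i, x ord0 i <= a ord0 i.
    apply: contrapT => /forallNP h; apply: nax; apply/mem_set => i.
    by have := h i => /negP; rewrite -ltNge.
  apply: (@squeeze_cvgr _ _ _ _ (fun=> 0) harmonic); last exact: cvg_harmonic.
    near=> m; rewrite expR_ge0/=.
    apply: le_trans (expRN_le_inv _); last by rewrite ltr0n.
    rewrite ler_expR lerN2 (bigD1 i)//=.
    apply: (@le_trans _ _ (expR (m.+1%:R - m.+1%:R ^+ 2 * (x ord0 i - a ord0 i)))).
      apply: le_trans (expR_ge1Dx _); rewrite addrA lerBrDr.
      rewrite (@le_trans _ _ m.+1%:R)//; last by rewrite lerDr.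
      by rewrite gerDl mulr_ge0_le0 ?exprn_ge0// subr_le0.
    by rewrite lerDl sumr_ge0// => j _; exact: expR_ge0.
  exact: cvg_cst.
Unshelve. all: by end_near. Qed.

Variable h : Rn -> R.
Hypothesis mh : measurable_fun setT h.
Hypothesis hG : mu.-integrable setT (EFin \o (fun x => h x * gauss x)).
Hypothesis h0 : forall p q, \int[mu]_x (h x * cutoff_gauss p q 0 x) = 0.

Let H x := h x * gauss x.

Let mgauss : measurable_fun setT gauss.
Proof.
apply: (measurableT_comp (@measurable_expR R)).
by apply: measurable_funN; exact: measurable_dotp.
Qed.

Let mphi a m : measurable_fun setT (phi a m).
Proof.
apply: continuous_measurable_rV.
exact: test_fun_continuous (test_gauss _ _ _).
Qed.

(** Pi-lambda argument: the measurable sets on which H has zero integral form a lambda-system, and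
    they include the orthants because the vanishing pairings with [phi a m] converge to the integral
    of H there, with |H| as majorant. *)
Let intH0 A : measurable A -> \int[mu]_(x in A) H x = 0.
Proof.
move=> /orthants_generate.
pose L : set (set Rn) := [set A | measurable A /\ \int[mu]_(x in A) H x = 0].
have HA B : measurable B -> mu.-integrable B (EFin \o H).
  by move=> mB; apply: integrableS hG.
have LO a : L (orthant a).
  split; first exact: measurable_orthant.
  have [|||mm|_] := @Rintegral_dominated_cvg _ _ R mu (fun m x => h x * phi a m x)
     (fun x => h x * (gauss x * \1_(orthant a) x)) (fun x => `|H x|).
  - by move=> m; apply: measurable_funM; [exact: mh|exact: mphi].
  - by move=> x; apply: cvgM; [exact: cvg_cst|exact: phi_cvg].
  - exact: integrable_abse hG.
  - move=> x; rewrite /H !normrM ler_wpM2l// ger0_norm ?expR_ge0//.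
    by rewrite ger0_norm ?expR_ge0// cutoff_gauss_le_gauss.
  under eq_fun do rewrite h0.
  move=> c0; have := cvg_unique _ (cvg_cst 0) c0 => /(_ (@norm_hausdorff _ _)) E.
  rewrite Rintegral_mkcond; transitivity (0 : R) => //; rewrite [RHS]E.
  by apply: eq_Rintegral => x _; rewrite /H patchE indicE; case: ifP; rewrite ?mulr1 ?mulr0.
have Lnd : ndseq_closed L.
  move=> F ndF LF; split; first by apply: bigcupT_measurable => k; exact: (LF k).1.
  have [|||mm|_] := @Rintegral_dominated_cvg _ _ R mu (fun m => H \_ (F m))
     (H \_ (\bigcup_k F k)) (fun x => `|H x|).
  - move=> m; apply/(measurable_restrictT _ (LF m).1).
    have /measurable_EFinP : measurable_fun setT (EFin \o H) by exact: measurable_int hG.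
    exact: measurable_funTS.
  - move=> x; rewrite patchE; case: ifPn => [/set_mem[k _ Fk]|/negP nF].
      apply: cvg_near_cst; near=> m.
      rewrite patchE mem_set//.
      have /ndF/subsetPset : (k <= m)%N by near: m; exact: nbhs_infty_ge.
      exact.
    rewrite (_ : (fun _ => _) = fun=> 0); first exact: cvg_cst.
    apply/funext => m; rewrite patchE memNset// => Fm.
    by apply: nF; apply/mem_set; exists m.
  - exact: integrable_abse hG.
  - by move=> x; rewrite patchE; case: ifP => // _; rewrite normr0.
  under eq_fun do rewrite -Rintegral_mkcond (LF _).2.
  move=> c0; have := cvg_unique _ (cvg_cst 0) c0 => /(_ (@norm_hausdorff _ _)) E.
  by rewrite Rintegral_mkcond -E.
(* The whole space is an increasing union of the orthants with all bounds - m. *)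
have LT : L setT.
  have -> : setT = \bigcup_m orthant (const_mx (- m%:R) : Rn).
    apply/seteqP; split => // x _.
    exists (Num.truncn (\sum_j `|x ord0 j|)).+1 => // j.
    rewrite mxE ltrNl (le_lt_trans (ler_norm _))// normrN.
    apply: le_lt_trans (truncnS_gt _).
    by rewrite (bigD1 j)//= lerDl sumr_ge0.
  apply: Lnd => // i j ij; apply/subsetPset => x /= ox k.
  by apply: le_lt_trans (ox k); rewrite !mxE lerN2 ler_nat.
suff lamL : lambda_system setT L.
  have sub : <<s @orthants R n >> `<=` L.
    apply: (lambda_system_subset (@setI_closed_orthants R n) lamL) => //.
    by move=> _ [a _ <-]; exact: LO.
  by move=> /sub[].
split; [by []|exact: LT| |exact: Lnd].
move=> B C CB [mB B0] [mC C0].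
split; first exact: measurableD.
have := @Rintegral_setU _ _ _ mu (B `\` C) C H (measurableD mB mC) mC.
rewrite (setUC (B `\` C)) setDUK// B0 C0 addr0 => <-//; first exact: HA.
by apply/disj_setPS => x [[]].
Unshelve. all: by end_near. Qed.

(** A function whose integral vanishes on every measurable set is zero almost everywhere, and the
    Gaussian factor of [H] never vanishes. That factor is there to make the integrals finite when h
    has polynomial growth. *)
Lemma schwartz_pairing_eq0 : {ae mu, forall x, h x = 0}.
Proof.
have : ae_eq mu setT (EFin \o H) (cst 0%E).
  apply: integral_ae_eq => //.
  move=> E _ mE; rewrite integral_cst// mul0e.
  have := intH0 mE; rewrite /Rintegral => E0.
  rewrite -[LHS]fineK ?E0//.
  by apply: integrable_fin_num => //; exact: integrableS hG.
apply: filterS => x /(_ I) /= [] /eqP.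
by rewrite mulf_eq0 (gt_eqF (expR_gt0 _)) orbF => /eqP.
Qed.

End uniqueness.

(** * Pointwise convergent subsequences *)

(** Compactness of [-Q, Q] gives a cluster point of the image filter. A neighbourhood of it whose
    preimage were not in U would have its complement in the image filter, contradicting
    clustering. *)
Lemma ultra_bounded_cvg (R : realType) (U : set_system nat) (a : nat -> R) (Q : R) :
  UltraFilter U -> (forall k, `|a k| <= Q) -> exists p : R, a k @[k --> U] --> p.
Proof.
move=> UU aQ; have UP : ProperFilter U by exact: ultra_proper.
have aU : (a @ U) `[- Q, Q]%classic.
  have : U (a @^-1` `[- Q, Q]) by apply: filterE => k /=; rewrite in_itv/= -ler_norml.
  by [].
have [p [_ clp]] := @segment_compact _ (- Q) Q _ _ aU; exists p => V Vp.
case: (in_ultra_setVsetC (a @^-1` V) UU) => // UV.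
have [x [nVx Vx]] := clp _ _ (UV : (a @ U) (~` V)) Vp.
by [].
Qed.

Section pointwise_subsequence.
Variables (R : realType) (n : nat) (F : nat -> bool -> 'rV[R]_n -> R) (Q L : R).
Hypothesis L0 : 0 <= L.
Hypothesis FQ : forall k c x, `|F k c x| <= Q.
Hypothesis FL : forall k c x y,
  `|F k c x - F k c y| <= L * \sum_i `|x ord0 i - y ord0 i|.

Let rat_rV (q : 'rV[rat]_n) : 'rV[R]_n := map_mx ratr q.

(* An ultrafilter provides a candidate limit at every point at once; rational
   points then suffice to select the subsequence. *)
Lemma pointwise_subsequence : exists2 sigma : nat -> nat,
  {homo sigma : i j / (i < j)%N} &
  exists p : bool -> 'rV[R]_n -> R, forall c x, F (sigma j) c x @[j --> \oo] --> p c x.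
Proof.
have [U [UU sU]] := @ultraFilterLemma nat \oo _.
have UP : ProperFilter U by exact: ultra_proper.
have /choice[p Fp] : forall cx : bool * 'rV[R]_n,
    exists l : R, F k cx.1 cx.2 @[k --> U] --> l.
  by move=> [c x]; apply: (ultra_bounded_cvg UU) => k; exact: FQ.
have pL c x y : `|p (c, x) - p (c, y)| <= L * \sum_i `|x ord0 i - y ord0 i|.
  apply: (cvgr_to_le (cvg_norm (cvgB (Fp (c, x)) (Fp (c, y))))).
  by apply: nearW => k; exact: FL.
(* The codes m enumerate the pairs of a component and a rational point; a number that codes no pair
   imposes no condition. *)
pose close j k (m : nat) := if unpickle m is Some (c, q)
  then `|p (c, rat_rV q) - F k c (rat_rV q)| < j.+1%:R^-1 else true.
(* Stage j imposes finitely many conditions, each true on a set of U, and N < k also holds on such a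
   set since U refines [\oo]; hence some k meets them all. *)
have next j N : exists k, (N < k)%N /\ forall m : 'I_j.+1, close j k m.
  apply: (@filter_ex _ U); apply: filterI; first by apply: sU; exact: nbhs_infty_gt.
  apply: filter_forall => m; rewrite /close.
  case: (unpickle m) => [[c q]|]; last exact: filterE.
  move/cvgrPdist_lt : (Fp (c, rat_rV q)); apply.
  by rewrite invr_gt0 ltr0n.
have /choice[h hP] : forall jN : nat * nat, exists k, (jN.2 < k)%N /\
    forall m : 'I_jN.1.+1, close jN.1 k m by move=> [j N]; exact: next.
pose sigma := fix s j := if j is j'.+1 then h (j, s j') else h (0%N, 0%N).
have close_sigma j (m : 'I_j.+1) : close j (sigma j) m.
  by case: j m => [|j] m; exact: (hP _).2.
exists sigma.
  apply: homo_ltn => [x y z|j]; first exact: ltn_trans.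
  exact: (hP (j.+1, sigma j)).1.
exists (fun c x => p (c, x)) => c x; apply/cvgrPdist_lt => e e0.
have Ln : 0 < 3 * (L * n%:R + 1) by rewrite mulr_gt0// ltr_wpDl// mulr_ge0.
(* The Lipschitz bound then moves both F and p by at most e / 3 between x and a rational point y
   with coordinates within d; the + 1 avoids a zero denominator when L n = 0. *)
pose d := e / (3 * (L * n%:R + 1)).
have d0 : 0 < d by rewrite divr_gt0.
have /choice[q qx] : forall i, exists q : rat, `|x ord0 i - ratr q| < d.
  move=> i; have [|q] := @rat_in_itvoo R (x ord0 i - d) (x ord0 i + d).
    by rewrite ltrBlDr -addrA ltrDl addr_gt0.
  by rewrite in_itv/= => xq; exists q; rewrite distrC ltr_distl.
pose y := rat_rV (\row_i q i).
have xy : L * \sum_i `|x ord0 i - y ord0 i| <= e / 3.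
  apply: (@le_trans _ _ (L * (n%:R * d))).
    rewrite ler_wpM2l// -[n in n%:R]card_ord -sum1_card natr_sum mulr_suml.
    by apply: ler_sum => i _; rewrite mul1r ltW// !mxE.
  have Ln1 : 0 < L * n%:R + 1 by rewrite ltr_wpDl// mulr_ge0.
  have -> : L * (n%:R * d) = e / 3 * (L * n%:R / (L * n%:R + 1)).
    by rewrite /d; field; rewrite gt_eqF.
  rewrite ler_piMr ?divr_ge0 ?(ltW e0)// ler_pdivrMr// mul1r lerDl//.
near=> j.
have jm : (pickle (c, \row_i q i : 'rV[rat]_n) < j.+1)%N.
  by rewrite ltnS; near: j; exact: nbhs_infty_ge.
have := close_sigma j (Ordinal jm); rewrite /close pickleK => hj.
have je : j.+1%:R^-1 < e / 3.
  near: j; have := @cvg_harmonic R => /cvgrPdist_lt /(_ (e / 3)).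
  have e3 : 0 < e / 3 by rewrite divr_gt0.
  move=> /(_ e3); apply: filterS => j; rewrite sub0r normrN ger0_norm//.
  exact: harmonic_ge0.
have -> : p (c, x) - F (sigma j) c x = (p (c, x) - p (c, y)) +
  (p (c, y) - F (sigma j) c y) + (F (sigma j) c y - F (sigma j) c x) by ring.
have h1 := le_trans (pL c x y) xy.
have h2 : `|F (sigma j) c y - F (sigma j) c x| <= e / 3.
  by rewrite distrC; exact: le_trans (FL _ _ _ _) xy.
have h3 : `|p (c, y) - F (sigma j) c y| < e / 3 by exact: lt_trans hj je.
apply: (le_lt_trans (ler_normD _ _)).
apply: (le_lt_trans (lerD (ler_normD _ _) (lexx _))).
by move: h1 h2 h3; lra.
Unshelve. all: by end_near. Qed.

End pointwise_subsequence.

(** * Complex-valued functions *)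

Local Open Scope complex_scope.

Section complex_parts.
Variable R : realType.
Implicit Types (z w : R[i]).

Lemma Re_scalec (c : R) z : complex.Re (c%:C * z) = c * complex.Re z.
Proof. by case: z => a b; rewrite /= mul0r subr0. Qed.

Lemma Im_scalec (c : R) z : complex.Im (c%:C * z) = c * complex.Im z.
Proof. by case: z => a b; rewrite /= mul0r addr0. Qed.

Lemma Re_mulc z w : complex.Re (z * w) =
  complex.Re z * complex.Re w - complex.Im z * complex.Im w.
Proof. by case: z => a b; case: w. Qed.

Lemma Im_mulc z w : complex.Im (z * w) =
  complex.Re z * complex.Im w + complex.Im z * complex.Re w.
Proof. by case: z => a b; case: w. Qed.

Lemma ReB z w : complex.Re (z - w) = complex.Re z - complex.Re w.
Proof. by case: z => a b; case: w. Qed.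

Lemma ImB z w : complex.Im (z - w) = complex.Im z - complex.Im w.
Proof. by case: z => a b; case: w. Qed.

Lemma eq_Re_Im z w : complex.Re z = complex.Re w ->
  complex.Im z = complex.Im w -> z = w.
Proof. by case: z => a b; case: w => c d /= -> ->. Qed.

Lemma normcE z :
  Normc.normc z = Num.sqrt (complex.Re z ^+ 2 + complex.Im z ^+ 2).
Proof. by case: z. Qed.

Lemma normc_ge0 z : 0 <= Normc.normc z.
Proof. by rewrite normcE sqrtr_ge0. Qed.

Lemma normRe_le z : `|complex.Re z| <= Normc.normc z.
Proof. by rewrite normcE -sqrtr_sqr ler_wsqrtr// lerDl sqr_ge0. Qed.

Lemma normIm_le z : `|complex.Im z| <= Normc.normc z.
Proof. by rewrite normcE -sqrtr_sqr ler_wsqrtr// lerDr sqr_ge0. Qed.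

Lemma normc_le z : Normc.normc z <= `|complex.Re z| + `|complex.Im z|.
Proof.
rewrite normcE -[X in _ <= X]ger0_norm ?addr_ge0// -sqrtr_sqr ler_wsqrtr//.
rewrite sqrrD !real_normK ?num_real// -addrA lerD2l lerDr.
by rewrite mulrn_wge0// mulr_ge0.
Qed.

Lemma normrc z : `|z| = (Normc.normc z)%:C :> R[i].
Proof. by case: z. Qed.

Lemma normc_leP (M : R) z : (`|z| <= M%:C) = (Normc.normc z <= M).
Proof. by rewrite normrc lecE /= eqxx. Qed.

Lemma normcB_triangle z w x :
  Normc.normc (z - x) <= Normc.normc (z - w) + Normc.normc (w - x).
Proof.
rewrite -lecR rmorphD /= -!normrc.
by rewrite -[z - x](subrKA w) ler_normD.
Qed.

Lemma normcN z : Normc.normc (- z) = Normc.normc z.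
Proof. by case: z => a b; rewrite /= !sqrrN. Qed.

Lemma normcB_norm_le z w :
  `|Normc.normc z - Normc.normc w| <= Normc.normc (z - w).
Proof.
have h1 := normcB_triangle z w 0; have h2 := normcB_triangle w z 0.
rewrite !subr0 in h1 h2; rewrite -(opprB z) normcN in h2.
by rewrite ler_norml; apply/andP; split; move: h1 h2; lra.
Qed.

End complex_parts.

Section cvg_complex.
Variables (R : realType) (T : Type) (F : set_system T).
Context {FF : Filter F}.
Implicit Types (f : T -> R[i]) (l : R[i]).

Lemma cvg_Re f l : (f : T -> R[i]^o) @ F --> (l : R[i]^o) ->
  (fun x => complex.Re (f x)) @ F --> complex.Re l.
Proof.
move=> fl; apply/cvgrPdist_lt => e e0.
move/cvgrPdist_lt : fl => /(_ e%:C); rewrite ltcR => /(_ e0).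
apply: filterS => y; rewrite normrc ltcR.
by apply: le_lt_trans; rewrite -ReB normRe_le.
Qed.

Lemma cvg_Im f l : (f : T -> R[i]^o) @ F --> (l : R[i]^o) ->
  (fun x => complex.Im (f x)) @ F --> complex.Im l.
Proof.
move=> fl; apply/cvgrPdist_lt => e e0.
move/cvgrPdist_lt : fl => /(_ e%:C); rewrite ltcR => /(_ e0).
apply: filterS => y; rewrite normrc ltcR.
by apply: le_lt_trans; rewrite -ImB normIm_le.
Qed.

Lemma cvg_complex f l : (fun x => complex.Re (f x)) @ F --> complex.Re l ->
  (fun x => complex.Im (f x)) @ F --> complex.Im l ->
  (f : T -> R[i]^o) @ F --> (l : R[i]^o).
Proof.
move=> cR cI; apply/cvgrPdist_lt => -[e e'].
(* In the order of [R[i]] a positive number has zero imaginary part. *)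
rewrite ltcE /= => /andP[/eqP -> e0].
have e2 : 0 < e / 2 by rewrite divr_gt0.
move/cvgrPdist_lt : cI => /(_ _ e2); move/cvgrPdist_lt : cR => /(_ _ e2).
apply: filterS2 => y hR hI; rewrite normrc ltcE /= eqxx /=.
rewrite (le_lt_trans (normc_le _))// ReB ImB (splitr e).
exact: ltrD.
Qed.

End cvg_complex.

Section continuous_complex.
Variables (R : realType) (n : nat).
Local Notation Rn := 'rV[R]_n.
Implicit Types f : Rn -> R[i].

Lemma continuous_Re f : continuous (f : Rn -> R[i]^o) ->
  continuous (fun x => complex.Re (f x)).
Proof. by move=> cf x; exact: (@cvg_Re _ _ (nbhs x) _ f (f x) (cf x)). Qed.

Lemma continuous_Im f : continuous (f : Rn -> R[i]^o) ->
  continuous (fun x => complex.Im (f x)).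
Proof. by move=> cf x; exact: (@cvg_Im _ _ (nbhs x) _ f (f x) (cf x)). Qed.

Lemma continuous_complex f : continuous (fun x => complex.Re (f x)) ->
  continuous (fun x => complex.Im (f x)) -> continuous (f : Rn -> R[i]^o).
Proof.
by move=> cR cI x; exact: (@cvg_complex _ _ (nbhs x) _ f (f x) (cR x) (cI x)).
Qed.

End continuous_complex.

(** * The multiplication formula for the Fourier transform *)

Section fourier_pairing.
Variables (R : realType) (n : nat).
Local Notation Rn := 'rV[R]_n.
Local Notation mu := (lebesgue_rV R n).
Local Notation Re := (@complex.Re R).
Local Notation Im := (@complex.Im R).
Implicit Types (u v : Rn -> R) (f g w phi : Rn -> R[i]).

Lemma Re_fourier f xi : Re (fourier f xi) =
  \int[mu]_x (cos (dotp x xi) * Re (f x) + sin (dotp x xi) * Im (f x)).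
Proof. by apply: eq_Rintegral => x _; rewrite Re_mulc /= mulNr opprK. Qed.

Lemma Im_fourier f xi : Im (fourier f xi) =
  \int[mu]_x (cos (dotp x xi) * Im (f x) - sin (dotp x xi) * Re (f x)).
Proof. by apply: eq_Rintegral => x _; rewrite Im_mulc /= mulNr. Qed.

Let intg u := mu.-integrable setT (EFin \o u).

Let cosi z u : intg u -> intg (fun x => cos (dotp x z) * u x).
Proof. by move=> ui; rewrite /intg; under eq_fun do rewrite dotpC; exact: integrable_cosM. Qed.

Let sini z u : intg u -> intg (fun x => sin (dotp x z) * u x).
Proof. by move=> ui; rewrite /intg; under eq_fun do rewrite dotpC; exact: integrable_sinM. Qed.

(** [C u v] and [S u v] are u times the cosine and the sine transform of v. Real and imaginary parts
    of both pairings are signed sums of such terms. *)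
Let C u v x := u x * \int[mu]_y (cos (dotp y x) * v y).
Let S u v x := u x * \int[mu]_y (sin (dotp y x) * v y).

Let mdot : measurable_fun setT (fun p : Rn * Rn => dotp p.2 p.1).
Proof. exact: measurable_dotp. Qed.

Let swapC u v : intg u -> intg v ->
  intg (C u v) /\ \int[mu]_x C u v x = \int[mu]_x C v u x.
Proof.
move=> ui vi.
have mc : measurable_fun setT (fun p : Rn * Rn => cos (dotp p.2 p.1)).
  exact: (measurableT_comp (@measurable_cos R)).
have [h1 h2] := Rintegral_swap mc (fun=> cos_norm_le1 _) ui vi.
split; first exact: h1.
rewrite [LHS]h2; apply: eq_Rintegral => y _; congr (_ * _).
by apply: eq_Rintegral => x _; rewrite dotpC.
Qed.

Let swapS u v : intg u -> intg v ->
  intg (S u v) /\ \int[mu]_x S u v x = \int[mu]_x S v u x.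
Proof.
move=> ui vi.
have mc : measurable_fun setT (fun p : Rn * Rn => sin (dotp p.2 p.1)).
  exact: (measurableT_comp (@measurable_sin R)).
have [h1 h2] := Rintegral_swap mc (fun=> sin_norm_le1 _) ui vi.
split; first exact: h1.
rewrite [LHS]h2; apply: eq_Rintegral => y _; congr (_ * _).
by apply: eq_Rintegral => x _; rewrite dotpC.
Qed.

Let ReE f x (c : R) : cintegrable f -> c * Re (fourier f x) =
  c * \int[mu]_y (cos (dotp y x) * Re (f y)) + c * \int[mu]_y (sin (dotp y x) * Im (f y)).
Proof.
by move=> [fr fi]; rewrite Re_fourier RintegralD ?mulrDr//; [exact: cosi|exact: sini].
Qed.

Let ImE f x (c : R) : cintegrable f -> c * Im (fourier f x) =
  c * \int[mu]_y (cos (dotp y x) * Im (f y)) - c * \int[mu]_y (sin (dotp y x) * Re (f y)).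
Proof.
by move=> [fr fi]; rewrite Im_fourier RintegralB ?mulrBr//; [exact: cosi|exact: sini].
Qed.

Let intD u v : intg u -> intg v -> intg (fun x => u x + v x).
Proof. by move=> ui vi; exact: (integrableD measurableT ui vi). Qed.

Let intB u v : intg u -> intg v -> intg (fun x => u x - v x).
Proof. by move=> ui vi; exact: (integrableB measurableT ui vi). Qed.

Let Rintegral_DB u1 u2 u3 u4 : intg u1 -> intg u2 -> intg u3 -> intg u4 ->
  \int[mu]_x ((u1 x + u2 x) - (u3 x - u4 x)) =
  \int[mu]_x u1 x + \int[mu]_x u2 x - (\int[mu]_x u3 x - \int[mu]_x u4 x).
Proof.
move=> i1 i2 i3 i4.
rewrite (RintegralB measurableT (intD i1 i2) (intB i3 i4)).
by rewrite (RintegralD measurableT i1 i2) (RintegralB measurableT i3 i4).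
Qed.

Let Rintegral_BD u1 u2 u3 u4 : intg u1 -> intg u2 -> intg u3 -> intg u4 ->
  \int[mu]_x ((u1 x - u2 x) + (u3 x + u4 x)) =
  \int[mu]_x u1 x - \int[mu]_x u2 x + (\int[mu]_x u3 x + \int[mu]_x u4 x).
Proof.
move=> i1 i2 i3 i4.
rewrite (RintegralD measurableT (intB i1 i2) (intD i3 i4)).
by rewrite (RintegralB measurableT i1 i2) (RintegralD measurableT i3 i4).
Qed.

(** The kernel exp (- i x.xi) is bounded and symmetric in x and xi, so Fubini exchanges the roles of
    w and phi in each real term; only the order and grouping of the four terms change. *)
Lemma fourier_pairing w phi : cintegrable w -> cintegrable phi ->
  cintegral (fun x => w x * fourier phi x) = cintegral (fun xi => fourier w xi * phi xi).
Proof.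
move=> wi phii; have [[ai bi] [pi_ qi]] := (wi, phii).
set a := fun x => Re (w x) in ai; set b := fun x => Im (w x) in bi.
set p := fun x => Re (phi x) in pi_; set q := fun x => Im (phi x) in qi.
have [Cap CapE] := swapC ai pi_; have [Saq SaqE] := swapS ai qi.
have [Cbq CbqE] := swapC bi qi; have [Sbp SbpE] := swapS bi pi_.
have [Caq CaqE] := swapC ai qi; have [Sap SapE] := swapS ai pi_.
have [Cbp CbpE] := swapC bi pi_; have [Sbq SbqE] := swapS bi qi.
have [Cpa _] := swapC pi_ ai; have [Sqa _] := swapS qi ai.
have [Cqb _] := swapC qi bi; have [Spb _] := swapS pi_ bi.
have [Cqa _] := swapC qi ai; have [Spa _] := swapS pi_ ai.
have [Cpb _] := swapC pi_ bi; have [Sqb _] := swapS qi bi.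
apply: eq_Re_Im; rewrite [LHS]/= [RHS]/=.
- transitivity (\int[mu]_x ((C a p x + S a q x) - (C b q x - S b p x))).
    by apply: eq_Rintegral => x _; rewrite Re_mulc (ReE _ _ phii) (ImE _ _ phii).
  rewrite (Rintegral_DB Cap Saq Cbq Sbp) CapE SaqE CbqE SbpE.
  transitivity (\int[mu]_x ((C p a x + S p b x) - (C q b x - S q a x))); last first.
    apply: eq_Rintegral => x _; rewrite Re_mulc (mulrC (Re (fourier _ _))) (mulrC (Im (fourier _ _))).
    by rewrite (ReE _ _ wi) (ImE _ _ wi).
  rewrite (Rintegral_DB Cpa Spb Cqb Sqa).
  have arith (x1 x2 x3 x4 : R) : x1 + x2 - (x3 - x4) = x1 + x4 - (x3 - x2) by ring.
  exact: arith.
- transitivity (\int[mu]_x ((C a q x - S a p x) + (C b p x + S b q x))).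
    by apply: eq_Rintegral => x _; rewrite Im_mulc (ReE _ _ phii) (ImE _ _ phii).
  rewrite (Rintegral_BD Caq Sap Cbp Sbq) CaqE SapE CbpE SbqE.
  transitivity (\int[mu]_x ((C p b x - S p a x) + (C q a x + S q b x))); last first.
    apply: eq_Rintegral => x _; rewrite Im_mulc (mulrC (Re (fourier _ _))) (mulrC (Im (fourier _ _))).
    by rewrite (ReE _ _ wi) (ImE _ _ wi) addrC.
  rewrite (Rintegral_BD Cpb Spa Cqa Sqb).
  have arith (x1 x2 x3 x4 : R) : x1 - x2 + (x3 + x4) = x3 - x2 + (x1 + x4) by ring.
  exact: arith.
Qed.

End fourier_pairing.

(** * Compactly supported functions *)

Lemma lipschitz1_derive (R : realType) (f df : R -> R) :
  (forall x, is_derive x (1 : R) f (df x)) -> (forall x, `|df x| <= 1) ->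
  forall x y, `|f x - f y| <= `|x - y|.
Proof.
move=> fdf df1; have cf : continuous f.
  by move=> x; apply/differentiable_continuous/derivable1_diffP/ex_derive.
have H x y : x <= y -> `|f x - f y| <= `|x - y|.
  move=> xy; have [c _ E] := @MVT_segment _ f df x y xy (fun z _ => fdf z)
    (continuous_subspaceT cf).
  by rewrite distrC E normrM (distrC y) ler_piMl.
move=> x y; have [/H//|/ltW/H] := leP x y.
by rewrite distrC (distrC y).
Qed.

Lemma cos_lipschitz (R : realType) (x y : R) : `|cos x - cos y| <= `|x - y|.
Proof.
apply: (@lipschitz1_derive _ cos (fun x => - sin x)) => z.
by rewrite normrN; exact: sin_norm_le1.
Qed.

Lemma sin_lipschitz (R : realType) (x y : R) : `|sin x - sin y| <= `|x - y|.
Proof.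
apply: (@lipschitz1_derive _ sin cos) => z.
exact: cos_norm_le1.
Qed.

Lemma measurable_normc d (T : measurableType d) (R : realType) (f : T -> R[i]) :
  measurable_fun setT (fun x => complex.Re (f x)) ->
  measurable_fun setT (fun x => complex.Im (f x)) ->
  measurable_fun setT (fun x => Normc.normc (f x)).
Proof.
move=> mR mI; have -> : (fun x => Normc.normc (f x)) =
    (@powR R ^~ 2^-1) \o (fun x => complex.Re (f x) ^+ 2 + complex.Im (f x) ^+ 2).
  by apply/funext => x /=; rewrite normcE powR12_sqrt ?addr_ge0 ?sqr_ge0.
apply: measurableT_comp; first exact: measurable_powR.
by apply: measurable_funD; exact: measurable_funX.
Qed.

Section compact_support.
Variables (R : realType) (n : nat).
Local Notation Rn := 'rV[R]_n.
Local Notation mu := (lebesgue_rV R n).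
Local Notation Re := (@complex.Re R).
Local Notation Im := (@complex.Im R).

Lemma le_coord_norm (x : Rn) i : `|x ord0 i| <= `|x|.
Proof.
rewrite [X in _ <= X](_ : _ = mx_norm x)// mx_normrE.
exact: (le_bigmax _ (fun ij : 'I_1 * 'I_n => `|x ij.1 ij.2|) (ord0, i)).
Qed.

Lemma compact_subset_box (K : set Rn) : compact K ->
  exists2 r : R, 0 <= r & forall x, K x -> forall i, `|x ord0 i| <= r.
Proof.
move=> /compact_bounded[M [Mreal MK]]; exists (`|M| + 1) => [|x Kx i].
  by rewrite addr_ge0.
apply: le_trans (le_coord_norm x i) _; apply: MK Kx.
by rewrite (le_lt_trans (ler_norm M))// ltrDl.
Qed.

Variable r : R.
Hypothesis r0 : 0 <= r.
Implicit Types f w g : Rn -> R[i].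

(** Support in the box [-r, r]^n, expressed at the points where f is nonzero rather than on a
    closure: with r fixed, this passes at once to differences and to pointwise limits. *)
Definition compactly_supported f :=
  bounded_continuous f /\ forall x, f x != 0 -> forall i, `|x ord0 i| <= r.

(** The largest value of 1 / [cauchy_kernel] on the box. Hence D times the kernel dominates the
    indicator of the box. *)
Let D : R := (1 + r ^+ 2) ^+ n.

Let D0 : 0 <= D.
Proof. by rewrite exprn_ge0// addr_ge0// sqr_ge0. Qed.

Lemma cauchy_kernel_box (x : Rn) : (forall i, `|x ord0 i| <= r) ->
  1 <= D * cauchy_kernel x.
Proof.
move=> xr; have q0 : 0 < 1 + r ^+ 2 by rewrite ltr_pwDl// sqr_ge0.
have : \prod_(i < n) (1 + r ^+ 2)^-1 <= cauchy_kernel x.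
  apply: ler_prod => i _; rewrite invr_ge0 ltW//=.
  have o0 : 0 < oneDsqr (x ord0 i) := lt_le_trans ltr01 (oneDsqr_ge1 _).
  rewrite lef_pV2 ?posrE// /oneDsqr lerD2l -(real_normK (num_real (x ord0 i))).
  by rewrite lerXn2r ?nnegrE.
rewrite prodr_const card_ord => h.
apply: le_trans (ler_wpM2l D0 h).
by rewrite /D -exprMn mulfV ?expr1n// gt_eqF.
Qed.

Lemma le_cauchy_kernel f M x : compactly_supported f ->
  (forall x, Normc.normc (f x) <= M) -> Normc.normc (f x) <= M * D * cauchy_kernel x.
Proof.
move=> [_ sf] fM; have M0 : 0 <= M := le_trans (normc_ge0 (f x)) (fM x).
have [->|fx0] := eqVneq (f x) 0.
  rewrite Normc.normc0 !mulr_ge0// ltW//; exact: cauchy_kernel_gt0.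
apply: (le_trans (fM x)); rewrite -mulrA ler_peMr//.
exact: cauchy_kernel_box (sf _ fx0).
Qed.

Lemma compactly_supportedB f g : compactly_supported f -> compactly_supported g ->
  compactly_supported (f - g).
Proof.
move=> [[cf [M fM]] sf] [[cg [N gN]] sg]; split; last first.
  move=> x; have [f0|f0 _] := eqVneq (f x) 0; last exact: sf.
  by rewrite !fctE f0 sub0r oppr_eq0; exact: sg.
split; first by move=> x; exact: (@cvgB _ R[i]^o _ (nbhs x) _ f g _ _ (cf x) (cg x)).
exists (M + N) => x; rewrite rmorphD/= !fctE.
by rewrite (le_trans (ler_normB _ _))// lerD.
Qed.

Section one_function.
Variable f : Rn -> R[i].
Hypothesis sf : compactly_supported f.

Let cf : continuous (f : Rn -> R[i]^o). Proof. by case: sf => -[]. Qed.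

Lemma compactly_supported_bounded : exists M, forall x, Normc.normc (f x) <= M.
Proof. by case: sf => -[_ [M fM]] _; exists M => x; rewrite -normc_leP. Qed.

Lemma measurable_Re_cs : measurable_fun setT (fun x => Re (f x)).
Proof. exact: (continuous_measurable_rV (continuous_Re cf)). Qed.

Lemma measurable_Im_cs : measurable_fun setT (fun x => Im (f x)).
Proof. exact: (continuous_measurable_rV (continuous_Im cf)). Qed.

(** The estimates for functions in the box all take this route: domination by a multiple of the
    kernel replaces any computation of the volume of the box. *)
Lemma le_cauchy_integrable (h : Rn -> R) Q : measurable_fun setT h ->
  (forall x, `|h x| <= Q * cauchy_kernel x) ->
  mu.-integrable setT (EFin \o h) /\ `|\int[mu]_x h x| <= Q * pi ^+ n.
Proof.
move=> mh hQ.
have Qi := integrableZl measurableT Q (integrable_cauchy_kernel R n).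
have Q0 (x : Rn) : 0 <= Q * cauchy_kernel x by exact: (le_trans (normr_ge0 _) (hQ x)).
have hi : mu.-integrable setT (EFin \o h).
  apply: (le_integrable measurableT _ _ Qi); first exact/measurable_EFinP.
  by move=> x _; rewrite lee_fin (le_trans (hQ x))// ler_norm.
split => //; apply: (le_trans (le_normr_Rintegral measurableT hi)).
rewrite -Rintegral_cauchy_kernel -RintegralZl//; last exact: integrable_cauchy_kernel.
by apply: le_Rintegral => //; exact: integrable_abse hi.
Qed.

Lemma cintegrable_cs : cintegrable f.
Proof.
have [M fM] := compactly_supported_bounded.
split.
- apply: (@le_cauchy_integrable _ (M * D) measurable_Re_cs _).1 => x.
  exact: (le_trans (normRe_le _) (le_cauchy_kernel x sf fM)).
- apply: (@le_cauchy_integrable _ (M * D) measurable_Im_cs _).1 => x.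
  exact: (le_trans (normIm_le _) (le_cauchy_kernel x sf fM)).
Qed.

Section bounds.
Variable M : R.
Hypothesis fM : forall x, Normc.normc (f x) <= M.

Let trig_le (c s a b : R) : `|c| <= 1 -> `|s| <= 1 ->
  `|c * a + s * b| <= `|a| + `|b| /\ `|c * b - s * a| <= `|a| + `|b|.
Proof.
move=> c1 s1; split.
  by rewrite (le_trans (ler_normD _ _))// lerD// normrM ler_piMl.
by rewrite (le_trans (ler_normB _ _))// addrC lerD// normrM ler_piMl.
Qed.

Let ReIm_le x : `|Re (f x)| + `|Im (f x)| <= 2 * M * D * cauchy_kernel x.
Proof.
rewrite -!mulrA mulr_natl mulr2n mulrA lerD//.
  exact: (le_trans (normRe_le _) (le_cauchy_kernel x sf fM)).
exact: (le_trans (normIm_le _) (le_cauchy_kernel x sf fM)).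
Qed.

Let mcos xi : measurable_fun setT (fun x : Rn => cos (dotp x xi)).
Proof. by apply: (measurableT_comp (@measurable_cos R)); exact: measurable_dotp. Qed.

Let msin xi : measurable_fun setT (fun x : Rn => sin (dotp x xi)).
Proof. by apply: (measurableT_comp (@measurable_sin R)); exact: measurable_dotp. Qed.

Let mA xi : measurable_fun setT
  (fun x => cos (dotp x xi) * Re (f x) + sin (dotp x xi) * Im (f x)).
Proof.
by apply: measurable_funD; apply: measurable_funM => //;
  [exact: measurable_Re_cs|exact: measurable_Im_cs].
Qed.

Let mB xi : measurable_fun setT
  (fun x => cos (dotp x xi) * Im (f x) - sin (dotp x xi) * Re (f x)).
Proof.
by apply: measurable_funB; apply: measurable_funM => //;
  [exact: measurable_Im_cs|exact: measurable_Re_cs].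
Qed.

Let hA xi x : `|cos (dotp x xi) * Re (f x) + sin (dotp x xi) * Im (f x)| <=
  2 * M * D * cauchy_kernel x.
Proof.
apply: le_trans (ReIm_le x).
exact: (trig_le _ _ (cos_norm_le1 _) (sin_norm_le1 _)).1.
Qed.

Let hB xi x : `|cos (dotp x xi) * Im (f x) - sin (dotp x xi) * Re (f x)| <=
  2 * M * D * cauchy_kernel x.
Proof.
apply: le_trans (ReIm_le x).
exact: (trig_le _ _ (cos_norm_le1 _) (sin_norm_le1 _)).2.
Qed.

Lemma fourier_bound xi : `|Re (fourier f xi)| <= 2 * M * D * pi ^+ n /\
  `|Im (fourier f xi)| <= 2 * M * D * pi ^+ n.
Proof.
split.
  by rewrite Re_fourier; exact: (le_cauchy_integrable (mA xi) (hA xi)).2.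
by rewrite Im_fourier; exact: (le_cauchy_integrable (mB xi) (hB xi)).2.
Qed.

Let dist (x y : Rn) := \sum_i `|x ord0 i - y ord0 i|.

Let dotp_dist x xi eta : f x != 0 -> `|dotp x xi - dotp x eta| <= r * dist xi eta.
Proof.
move=> /(sf.2 _) xr; rewrite /dotp /dist -sumrB mulr_sumr.
apply: (le_trans (ler_norm_sum _ _ _)); apply: ler_sum => i _.
by rewrite -mulrBr normrM ler_wpM2r.
Qed.

Let dist_ge0 x y : 0 <= dist x y.
Proof. by apply: sumr_ge0. Qed.

Let lip_le (c s a b d : R) : 0 <= d -> `|c| <= d -> `|s| <= d ->
  `|c * a + s * b| <= d * (`|a| + `|b|) /\ `|c * b - s * a| <= d * (`|a| + `|b|).
Proof.
move=> d0 cd sd; split.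
  by rewrite (le_trans (ler_normD _ _))// mulrDr lerD// normrM ler_wpM2r.
by rewrite (le_trans (ler_normB _ _))// addrC mulrDr lerD// normrM ler_wpM2r.
Qed.

Let hLip xi eta x :
  `|(cos (dotp x xi) - cos (dotp x eta)) * Re (f x) +
    (sin (dotp x xi) - sin (dotp x eta)) * Im (f x)| <=
  r * dist xi eta * (2 * M * D) * cauchy_kernel x /\
  `|(cos (dotp x xi) - cos (dotp x eta)) * Im (f x) -
    (sin (dotp x xi) - sin (dotp x eta)) * Re (f x)| <=
  r * dist xi eta * (2 * M * D) * cauchy_kernel x.
Proof.
have d0 : 0 <= r * dist xi eta by rewrite mulr_ge0.
have [fx0|fx0] := eqVneq (f x) 0.
  rewrite fx0 /= !mulr0 addr0 subr0 normr0; split;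
  by rewrite -mulrA mulr_ge0// (le_trans _ (ReIm_le x))// addr_ge0.
have dx := dotp_dist xi eta fx0.
have [h1 h2] := lip_le (Re (f x)) (Im (f x)) d0
  (le_trans (cos_lipschitz _ _) dx) (le_trans (sin_lipschitz _ _) dx).
by split; rewrite -mulrA; [apply: (le_trans h1)|apply: (le_trans h2)]; rewrite ler_wpM2l.
Qed.

(** Cosine and sine are 1-Lipschitz, and where f is nonzero the phases x.xi and x.eta differ by at
    most r times the l^1 distance of xi and eta. *)
Lemma fourier_lipschitz xi eta :
  `|Re (fourier f xi) - Re (fourier f eta)| <=
    r * dist xi eta * (2 * M * D) * pi ^+ n /\
  `|Im (fourier f xi) - Im (fourier f eta)| <=
    r * dist xi eta * (2 * M * D) * pi ^+ n.
Proof.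
have iA z := (le_cauchy_integrable (mA z) (hA z)).1.
have iB z := (le_cauchy_integrable (mB z) (hB z)).1.
split.
- rewrite !Re_fourier -(RintegralB measurableT (iA xi) (iA eta)).
  apply: (le_cauchy_integrable _ _).2; first by apply: measurable_funB; exact: mA.
  move=> x; apply: le_trans (hLip xi eta x).1.
  by rewrite le_eqVlt; apply/orP; left; apply/eqP; congr (`| _ |); ring.
- rewrite !Im_fourier -(RintegralB measurableT (iB xi) (iB eta)).
  apply: (le_cauchy_integrable _ _).2; first by apply: measurable_funB; exact: mB.
  move=> x; apply: le_trans (hLip xi eta x).2.
  by rewrite le_eqVlt; apply/orP; left; apply/eqP; congr (`| _ |); ring.
Qed.

End bounds.
End one_function.
End compact_support.

(** * Classical and distributional transforms of functions supported in a box *)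

Section fhat.
Variables (R : realType) (n : nat) (r : R).
Hypothesis r0 : 0 <= r.
Local Notation Rn := 'rV[R]_n.
Local Notation mu := (lebesgue_rV R n).
Local Notation Re := (@complex.Re R).
Local Notation Im := (@complex.Im R).
Implicit Types f w g : Rn -> R[i].

Lemma continuous_lipschitz_coord (h : Rn -> R) (L : R) : 0 <= L ->
  (forall x y, `|h x - h y| <= L * \sum_i `|x ord0 i - y ord0 i|) -> continuous h.
Proof.
move=> L0 hL x.
have L1 : 0 < L * n%:R + 1 by rewrite ltr_wpDl// mulr_ge0.
apply/(@cvgrPdist_lt _ _ _ (nbhs x)) => e e0.
have : \forall y \near x, `|x - y| < e / (L * n%:R + 1).
  have : 0 < e / (L * n%:R + 1) by rewrite divr_gt0.
  by move: (e / _); apply/(@cvgrPdist_lt _ _ _ (nbhs x)); exact: cvg_id.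
apply: filterS => y xy; apply: (le_lt_trans (hL x y)).
apply: (@le_lt_trans _ _ ((L * n%:R + 1) * `|x - y|)); last first.
  by rewrite mulrC -ltr_pdivlMr.
rewrite mulrDl mul1r -mulrA; apply: (@le_trans _ _ (L * (n%:R * `|x - y|))); last first.
  by rewrite lerDl.
rewrite ler_wpM2l// -[n in n%:R]card_ord -sum1_card natr_sum mulr_suml.
apply: ler_sum => i _; rewrite mul1r.
by have := le_coord_norm (x - y) i; rewrite !mxE.
Qed.

Lemma cmeasurable_fourier f : compactly_supported r f -> cmeasurable (fourier f).
Proof.
move=> sf; have [M fM] := compactly_supported_bounded sf.
have M0 : 0 <= M := le_trans (normc_ge0 (f 0)) (fM 0).
pose L := r * (2 * M * (1 + r ^+ 2) ^+ n) * pi ^+ n.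
have L0 : 0 <= L.
  have p0 : 0 <= pi ^+ n :> R by rewrite exprn_ge0// pi_ge0.
  have q0 : 0 <= (1 + r ^+ 2) ^+ n by rewrite exprn_ge0// addr_ge0// sqr_ge0.
  by rewrite /L !mulr_ge0.
split; apply: continuous_measurable_rV; apply: (continuous_lipschitz_coord L0) => x y.
- apply: (le_trans (fourier_lipschitz r0 sf fM x y).1).
  by rewrite le_eqVlt; apply/orP; left; apply/eqP; rewrite /L; ring.
- apply: (le_trans (fourier_lipschitz r0 sf fM x y).2).
  by rewrite le_eqVlt; apply/orP; left; apply/eqP; rewrite /L; ring.
Qed.

(** Each of the n factors 1 + x_i^2 is at most <x>^2. So a decay of order 2 n suffices for
    domination by a multiple of the kernel, which makes Schwartz functions and the Gaussian
    integrable. *)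
Lemma cauchy_kernel_japanese (x : Rn) : 1 <= japanese x ^+ n.*2 * cauchy_kernel x.
Proof.
have k0 : 0 < cauchy_kernel x := cauchy_kernel_gt0 x.
rewrite -ler_pdivrMr// mul1r -mul2n exprM japanese_sqr.
rewrite /cauchy_kernel prodfV invrK.
rewrite -[n in _ ^+ n]card_ord -prodr_const; apply: ler_prod => i _.
rewrite (le_trans ler01 (oneDsqr_ge1 _))/= /oneDsqr lerD2l expr2.
rewrite /dotp (bigD1 i)//= lerDl sumr_ge0// => j _.
by rewrite -expr2 sqr_ge0.
Qed.

Lemma integrable_real_schwartz (u : Rn -> R) : real_schwartz u ->
  mu.-integrable setT (EFin \o u).
Proof.
move=> [su du]; have [C HC] := du [::] n.*2.
have mu_ : measurable_fun setT u by exact: continuous_measurable_rV (su [::]).1.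
apply: (@le_cauchy_integrable _ _ u C mu_ _).1 => x.
have /= := HC x; have k0 : 0 < cauchy_kernel x := cauchy_kernel_gt0 x.
move=> h; rewrite -ler_pdivrMr//; apply: le_trans h.
rewrite ler_pdivrMr// mulrAC ler_peMl//.
exact: cauchy_kernel_japanese.
Qed.

Lemma cintegrable_schwartz phi : @schwartz R n phi -> cintegrable phi.
Proof. by move=> [h1 h2]; split; exact: integrable_real_schwartz. Qed.

Lemma is_fourier_classical f : compactly_supported r f -> cintegrable (fourier f) ->
  is_fourier f (fourier f).
Proof.
move=> sf fi; split.
  split; first exact: cmeasurable_fourier.
  by exists 0%N; under eq_fun do rewrite expr0 mul1r.
move=> phi /cintegrable_schwartz phii.
exact: fourier_pairing (cintegrable_cs r0 sf) phii.
Qed.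

(** Both g and [fourier f] have the same pairing with every cut-off, g by hypothesis and [fourier f]
    by the multiplication formula; the vanishing criterion is applied to the real and imaginary
    parts of the difference. *)
Lemma is_fourier_unique f g : compactly_supported r f -> is_fourier f g ->
  {ae mu, forall xi, g xi = fourier f xi}.
Proof.
move=> sf [[[mgR mgI] [N [gRi gIi]]] fg].
have [mfR mfI] := cmeasurable_fourier sf.
have [M fM] := compactly_supported_bounded sf.
have mgauss : measurable_fun setT (@gauss R n).
  apply: (measurableT_comp (@measurable_expR R)).
  by apply: measurable_funN; exact: measurable_dotp.
have gauss_decay k : exists C, forall x : Rn, japanese x ^+ k * gauss x <= C.
  have [C HC] := expR_dotp_decay R n k; exists C => x; apply: le_trans (HC x).
  rewrite ler_wpM2l ?exprn_ge0 ?(ltW (japanese_gt0 x))// ler_expR.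
  by have := dotp_ge0 x; lra.
have gauss_i : mu.-integrable setT (EFin \o @gauss R n).
  have [C HC] := gauss_decay n.*2.
  apply: (@le_cauchy_integrable _ _ (@gauss R n) C mgauss _).1 => x.
  rewrite ger0_norm ?expR_ge0//.
  have k0 : 0 < cauchy_kernel x := cauchy_kernel_gt0 x.
  rewrite -ler_pdivrMr//; apply: le_trans (HC x).
  rewrite ler_pdivrMr// mulrAC ler_peMl ?expR_ge0//.
  exact: cauchy_kernel_japanese.
have [C HC] := gauss_decay N.
have mJ : measurable_fun setT (fun x : Rn => japanese x ^+ N * gauss x).
  apply: measurable_funM => //; apply: measurable_funX.
  have -> : @japanese R n = (@powR R ^~ 2^-1) \o (fun x => 1 + dotp x x).
    apply/funext => x /=; rewrite powR12_sqrt ?addr_ge0 ?dotp_ge0//.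
  apply: measurableT_comp; first exact: measurable_powR.
  by apply: measurable_funD => //; exact: measurable_dotp.
have Jb (x : Rn) : `|japanese x ^+ N * gauss x| <= C.
  have G0 : 0 <= japanese x ^+ N * gauss x.
    by rewrite mulr_ge0 ?expR_ge0 ?exprn_ge0 ?(ltW (japanese_gt0 x)).
  by rewrite (ger0_norm G0).
(* Factor u [gauss] as (<x>^N [gauss]) (<x>^-N u), a bounded function times an integrable one. *)
have gauss_g (u : Rn -> R) :
    mu.-integrable setT (EFin \o (fun x => (japanese x)^-1 ^+ N * u x)) ->
    mu.-integrable setT (EFin \o (fun x => u x * gauss x)).
  move=> /(integrable_bounded_mul mJ Jb).
  apply: eq_integrable => // x _ /=; congr EFin.
  have J0 := japanese_gt0 x.
  rewrite exprVn mulrACA -mulrA; field.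
  by rewrite expf_neq0// gt_eqF.
have gR : mu.-integrable setT (EFin \o (fun x => Re (g x) * gauss x)).
  by apply: gauss_g; move: gRi; under eq_fun do rewrite Re_scalec.
have gI : mu.-integrable setT (EFin \o (fun x => Im (g x) * gauss x)).
  by apply: gauss_g; move: gIi; under eq_fun do rewrite Im_scalec.
have fR : mu.-integrable setT (EFin \o (fun x => Re (fourier f x) * gauss x)).
  exact: (integrable_bounded_mul mfR (fun x => (fourier_bound r0 sf fM x).1) gauss_i).
have fI : mu.-integrable setT (EFin \o (fun x => Im (fourier f x) * gauss x)).
  exact: (integrable_bounded_mul mfI (fun x => (fourier_bound r0 sf fM x).2) gauss_i).
have cut (u : Rn -> R) p q : measurable_fun setT u ->
    mu.-integrable setT (EFin \o (fun x => u x * gauss x)) ->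
    mu.-integrable setT (EFin \o (fun x => u x * cutoff_gauss p q 0 x)).
  move=> mu_ ui; apply: (le_integrable measurableT _ _ ui).
    apply/measurable_EFinP; apply: measurable_funM => //.
    exact: (continuous_measurable_rV (test_fun_continuous (test_gauss _ _ _))).
  move=> x _; rewrite lee_fin /= !normrM ler_wpM2l//.
  by rewrite !ger0_norm ?expR_ge0// cutoff_gauss_le_gauss.
have pair p q : cintegral (fun x => g x * (cutoff_gauss p q 0 x)%:C) =
    cintegral (fun x => fourier f x * (cutoff_gauss p q 0 x)%:C).
  have sphi : schwartz (fun x : Rn => (cutoff_gauss p q 0 x)%:C).
    split; last exact: real_schwartz0.
    exact: test_fun_schwartz (test_gauss _ _ _).
  rewrite -[LHS]/(distr g _) -fg//.
  exact: (fourier_pairing (cintegrable_cs r0 sf) (cintegrable_schwartz sphi)).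
have R0 : {ae mu, forall x, Re (g x) - Re (fourier f x) = 0}.
  apply: schwartz_pairing_eq0; first exact: measurable_funB.
    have := integrableB measurableT gR fR; apply: eq_integrable => // x _ /=.
    by rewrite mulrBl.
  move=> p q; under eq_Rintegral do rewrite mulrBl.
  rewrite RintegralB//; [|exact: cut|exact: cut].
  have E (w : Rn -> R[i]) : Re (cintegral (fun x => w x * (cutoff_gauss p q 0 x)%:C)) =
      \int[mu]_x (Re (w x) * cutoff_gauss p q 0 x).
    by apply: eq_Rintegral => x _; rewrite Re_mulc /= mulr0 subr0.
  by have := congr1 Re (pair p q); rewrite !E => ->; rewrite subrr.
have I0 : {ae mu, forall x, Im (g x) - Im (fourier f x) = 0}.
  apply: schwartz_pairing_eq0; first exact: measurable_funB.
    have := integrableB measurableT gI fI; apply: eq_integrable => // x _ /=.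
    by rewrite mulrBl.
  move=> p q; under eq_Rintegral do rewrite mulrBl.
  rewrite RintegralB//; [|exact: cut|exact: cut].
  have E (w : Rn -> R[i]) : Im (cintegral (fun x => w x * (cutoff_gauss p q 0 x)%:C)) =
      \int[mu]_x (Im (w x) * cutoff_gauss p q 0 x).
    by apply: eq_Rintegral => x _; rewrite Im_mulc /= mulr0 add0r.
  by have := congr1 Im (pair p q); rewrite !E => ->; rewrite subrr.
apply: filterS2 R0 I0 => x /subr0_eq Rx /subr0_eq Ix.
exact: eq_Re_Im.
Qed.

Lemma is_fourier_fhat f : (exists g, is_fourier f g) -> is_fourier f (fhat f).
Proof. by move=> fg; exact: xgetPex. Qed.

(** Whatever representative [xget] selects, it satisfies [is_fourier], and uniqueness applies to
    it. *)
Lemma fhat_ae f : compactly_supported r f -> (exists g, is_fourier f g) ->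
  {ae mu, forall xi, fhat f xi = fourier f xi}.
Proof. by move=> sf /is_fourier_fhat; exact: is_fourier_unique. Qed.

Lemma measurable_japanese : measurable_fun setT (@japanese R n).
Proof.
have -> : @japanese R n = (@powR R ^~ 2^-1) \o (fun x => 1 + dotp x x).
  by apply/funext => x /=; rewrite powR12_sqrt ?addr_ge0 ?dotp_ge0.
apply: measurableT_comp; first exact: measurable_powR.
by apply: measurable_funD => //; exact: measurable_dotp.
Qed.

End fhat.

(** * Weighted norms *)

Section weights.
Variables (R : realType) (n : nat).
Local Notation Rn := 'rV[R]_n.
Local Notation mu := (lebesgue_rV R n).
Local Notation Re := (@complex.Re R).
Local Notation Im := (@complex.Im R).
Implicit Types f w g : Rn -> R[i].

Definition weighted (s : R) g (xi : Rn) : R := japanese xi `^ s * Normc.normc (g xi).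

Lemma weighted_ge0 s g xi : 0 <= weighted s g xi.
Proof. by rewrite mulr_ge0 ?powR_ge0 ?normc_ge0. Qed.

Lemma measurable_japanese_powR s : measurable_fun setT (fun x : Rn => japanese x `^ s).
Proof.
apply: (measurableT_comp (measurable_powR s)); exact: measurable_japanese.
Qed.

Lemma measurable_weighted s g : cmeasurable g -> measurable_fun setT (weighted s g).
Proof.
move=> [mR mI]; apply: measurable_funM; first exact: measurable_japanese_powR.
exact: measurable_normc.
Qed.

Lemma le_weighted s t g xi : s <= t -> weighted s g xi <= weighted t g xi.
Proof.
move=> st; rewrite ler_wpM2r ?normc_ge0// ler_powR// japanese_ge1//.
Qed.

Lemma le_normc_weighted s g xi : 0 <= s -> Normc.normc (g xi) <= weighted s g xi.
Proof.
move=> s0; rewrite ler_peMl ?normc_ge0//.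
by rewrite -(powRr0 (japanese xi)) ler_powR// japanese_ge1.
Qed.

Lemma le_integrable_weighted s t g : s <= t -> cmeasurable g ->
  mu.-integrable setT (EFin \o weighted t g) -> mu.-integrable setT (EFin \o weighted s g).
Proof.
move=> st mg; apply: le_integrable => //.
  by apply/measurable_EFinP; exact: measurable_weighted.
move=> x _; rewrite lee_fin !ger0_norm ?weighted_ge0//.
exact: le_weighted.
Qed.

Lemma cintegrable_weightedP s g : cmeasurable g ->
  cintegrable (fun xi => (japanese xi `^ s)%:C * g xi) <->
  mu.-integrable setT (EFin \o weighted s g).
Proof.
move=> mg; have [mR mI] := mg; split=> [[iR iI]|iw].
  have h := integrableD measurableT (integrable_abse iR) (integrable_abse iI).
  apply: (le_integrable measurableT _ _ h).
    by apply/measurable_EFinP; exact: measurable_weighted.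
  move=> x _; rewrite /= lee_fin !Re_scalec !Im_scalec ger0_norm ?weighted_ge0//.
  rewrite [leRHS]ger0_norm ?addr_ge0// !normrM -mulrDr.
  by rewrite ger0_norm ?powR_ge0// ler_wpM2l ?powR_ge0// normc_le.
split; apply: (le_integrable measurableT _ _ iw).
- apply/measurable_EFinP; under eq_fun do rewrite Re_scalec.
  by apply: measurable_funM => //; exact: measurable_japanese_powR.
- move=> x _; rewrite /= lee_fin Re_scalec (ger0_norm (weighted_ge0 _ _ _)) normrM.
  by rewrite ger0_norm ?powR_ge0// ler_wpM2l ?powR_ge0// normRe_le.
- apply/measurable_EFinP; under eq_fun do rewrite Im_scalec.
  by apply: measurable_funM => //; exact: measurable_japanese_powR.
- move=> x _; rewrite /= lee_fin Im_scalec (ger0_norm (weighted_ge0 _ _ _)) normrM.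
  by rewrite ger0_norm ?powR_ge0// ler_wpM2l ?powR_ge0// normIm_le.
Qed.

Lemma cintegrable_weighted0 s g : 0 <= s -> cmeasurable g ->
  mu.-integrable setT (EFin \o weighted s g) ->
  cintegrable g /\ mu.-integrable setT (EFin \o (fun xi => Normc.normc (g xi))).
Proof.
move=> s0 mg iw; have [mR mI] := mg.
have mn : measurable_fun setT (fun xi => Normc.normc (g xi)) by exact: measurable_normc.
have iN : mu.-integrable setT (EFin \o (fun xi => Normc.normc (g xi))).
  apply: (le_integrable measurableT _ _ iw); first exact/measurable_EFinP.
  move=> x _; rewrite lee_fin !ger0_norm ?weighted_ge0 ?normc_ge0//.
  exact: le_normc_weighted.
split => //; split; apply: (le_integrable measurableT _ _ iN);
  rewrite ?(measurable_EFinP)// => x _; rewrite lee_fin (ger0_norm (normc_ge0 _)).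
- exact: normRe_le.
- exact: normIm_le.
Qed.

Lemma cmeasurable_fhat f : (exists g, is_fourier f g) -> cmeasurable (fhat f).
Proof. by move=> /is_fourier_fhat[[]]. Qed.

Lemma Bspace_le s t : s <= t -> @Bspace R n t `<=` Bspace s.
Proof.
move=> st f [bf ef cf]; split => //.
have mf := cmeasurable_fhat ef.
by apply/cintegrable_weightedP => //; apply: (le_integrable_weighted st) => //;
  apply/cintegrable_weightedP.
Qed.

Lemma Bnorm_le s t f : s <= t -> Bspace t f -> (Bnorm s f <= Bnorm t f)%E.
Proof.
move=> st [_ ef _]; have mf := cmeasurable_fhat ef.
apply: ge0_le_integral => //.
- by move=> x _; rewrite lee_fin weighted_ge0.
- by apply/measurable_EFinP; exact: measurable_weighted.
- by apply/measurable_EFinP; exact: measurable_weighted.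
- by move=> x _; rewrite lee_fin; exact: le_weighted.
Qed.

Variable r : R.
Hypothesis r0 : 0 <= r.

(** The integral does not see the choice made in [fhat], so from here on norms are computed with the
    classical transform. *)
Lemma Bnorm_cs s f : compactly_supported r f -> (exists g, is_fourier f g) ->
  (Bnorm s f = \int[mu]_xi (weighted s (fourier f) xi)%:E)%E.
Proof.
move=> sf ef; apply: ge0_ae_eq_integral => //.
- by apply/measurable_EFinP; exact: measurable_weighted (cmeasurable_fhat ef).
- by apply/measurable_EFinP; exact: measurable_weighted (cmeasurable_fourier r0 sf).
- by move=> x _; rewrite lee_fin weighted_ge0.
- by move=> x _; rewrite lee_fin weighted_ge0.
- by apply: filterS (fhat_ae r0 sf ef) => x E _; rewrite /= /weighted E.
Qed.

Lemma integrable_weighted_fhat s f : compactly_supported r f ->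
  (exists g, is_fourier f g) ->
  mu.-integrable setT (EFin \o weighted s (fhat f)) <->
  mu.-integrable setT (EFin \o weighted s (fourier f)).
Proof.
move=> sf ef; have := Bnorm_cs s sf ef; rewrite /Bnorm -/(weighted s _) => E.
have m1 := measurable_weighted s (cmeasurable_fhat ef).
have m2 := measurable_weighted s (cmeasurable_fourier r0 sf).
have absE g : (\int[mu]_x `|(EFin \o weighted s g) x| = \int[mu]_x (weighted s g x)%:E)%E.
  by apply: eq_integral => x _; rewrite /= ger0_norm ?weighted_ge0.
split=> /integrableP[_ h]; apply/integrableP; split; try exact/measurable_EFinP.
  by move: h; rewrite !absE -E.
by move: h; rewrite !absE -E.
Qed.

(** The inversion bound controls a real part only. It is applied to f and to - i f, whose real part
    is Im f and whose transform has real part Im and imaginary part - Re of [fourier f]. The 4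
    counts these two applications times |Re z| + |Im z| <= 2 |z|. *)
Lemma sup_le_fourier f x : compactly_supported r f -> cintegrable (fourier f) ->
  Normc.normc (f x) <= 4 * (2 ^+ n * pi ^+ n)^-1 * \int[mu]_xi Normc.normc (fourier f xi).
Proof.
move=> sf [iR iI]; have [M fM] := compactly_supported_bounded sf.
have [fR fI] := cintegrable_cs r0 sf.
have [[cf _] _] := sf.
have c0 : 0 <= (2 ^+ n * pi ^+ n)^-1 :> R.
  by rewrite invr_ge0 mulr_ge0 ?exprn_ge0// pi_ge0.
have RM y : `|Re (f y)| <= M by exact: (le_trans (normRe_le _) (fM y)).
have IM y : `|Im (f y)| <= M by exact: (le_trans (normIm_le _) (fM y)).
have fNR : mu.-integrable setT (EFin \o (fun x => - Re (f x))).
  by have := integrableN fR; apply: eq_integrable.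
have iNR : mu.-integrable setT (EFin \o (fun x => - Re (fourier f x))).
  by have := integrableN iR; apply: eq_integrable.
have ImE' xi : Im (fourier f xi) =
    \int[mu]_x (cos (dotp x xi) * Im (f x) + sin (dotp x xi) * - Re (f x)).
  by rewrite Im_fourier; apply: eq_Rintegral => y _; rewrite mulrN.
have ReE' xi : - Re (fourier f xi) =
    \int[mu]_x (cos (dotp x xi) * - Re (f x) - sin (dotp x xi) * Im (f x)).
  rewrite Re_fourier -mulN1r -RintegralZl//.
    by apply: eq_Rintegral => y _; rewrite mulN1r mulrN opprD.
  have := integrableD measurableT (integrable_cosM xi fR) (integrable_sinM xi fI).
  by apply: eq_integrable => // y _; rewrite /= !(dotpC xi).
have hR := fourier_inversion_bound (continuous_Re cf) RM fR fI
  (Re_fourier f) (Im_fourier f) iR iI x.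
have hI := fourier_inversion_bound (continuous_Im cf) IM fI fNR ImE' ReE' iI iNR x.
pose N xi := Normc.normc (fourier f xi).
have iN : mu.-integrable setT (EFin \o N).
  have h := integrableD measurableT (integrable_abse iR) (integrable_abse iI).
  apply: (le_integrable measurableT _ _ h).
    by apply/measurable_EFinP; apply: measurable_normc;
      apply/measurable_EFinP; [exact: measurable_int iR|exact: measurable_int iI].
  move=> y _; rewrite /= lee_fin ger0_norm ?normc_ge0//.
  by rewrite [leRHS]ger0_norm ?addr_ge0// normc_le.
have bound (u v : Rn -> R) : mu.-integrable setT (EFin \o u) ->
    mu.-integrable setT (EFin \o v) -> (forall y, `|u y| <= N y) ->
    (forall y, `|v y| <= N y) ->
    \int[mu]_y (`|u y| + `|v y|) <= 2 * \int[mu]_y N y.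
  move=> iu iv uN vN; rewrite -RintegralZl//; apply: le_Rintegral => //.
  - exact: (integrableD measurableT (integrable_abse iu) (integrable_abse iv)).
  - exact: (integrableZl measurableT 2 iN).
  - by move=> y _; rewrite mulr_natl mulr2n lerD.
have b1 := bound _ _ iR iI (fun y => normRe_le _) (fun y => normIm_le _).
have b2 : \int[mu]_y (`|Im (fourier f y)| + `|- Re (fourier f y)|) <= 2 * \int[mu]_y N y.
  by apply: bound => // y; rewrite ?normrN; [exact: normIm_le|exact: normRe_le].
apply: (le_trans (normc_le _)).
have {}hR := le_trans hR (ler_wpM2l c0 b1).
have {}hI := le_trans hI (ler_wpM2l c0 b2).
apply: (le_trans (lerD hR hI)).
rewrite le_eqVlt; apply/orP; left; apply/eqP; rewrite /N.
by move: (Rintegral _ _ _) (_^-1) => I c; ring.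
Qed.

End weights.

(** * Compactness *)

Lemma fatou_bound d (T : measurableType d) (R : realType)
    (mu : {measure set T -> \bar R}) (f_ : nat -> T -> R) (f : T -> R) (M : R) :
  (forall j, measurable_fun setT (f_ j)) -> (forall j x, 0 <= f_ j x) ->
  (forall x, f_ j x @[j --> \oo] --> f x) ->
  (forall j, (\int[mu]_x (f_ j x)%:E <= M%:E)%E) ->
  (\int[mu]_x (f x)%:E <= M%:E)%E.
Proof.
move=> mf f0 ff fM.
have mfE j : measurable_fun setT (EFin \o f_ j) by exact/measurable_EFinP.
have f0E j x : setT x -> (0 <= (EFin \o f_ j) x)%E by rewrite lee_fin.
have := fatou mu measurableT mfE f0E.
have -> : (\int[mu]_x limn_einf (fun j => (EFin \o f_ j) x) = \int[mu]_x (f x)%:E)%E.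
  apply: eq_integral => x _; have h : (EFin \o f_ ^~ x) j @[j --> \oo] --> (f x)%:E.
    by apply: cvg_EFin; [exact: nearW|exact: ff].
  by rewrite (cvg_limn_einf_sup h).1.
move=> /le_trans; apply; rewrite limn_einf_lim; apply: lime_le.
  exact: is_cvg_einfs.
apply: nearW => j; apply: le_trans (fM j).
by apply: ereal_inf_lbound; exists j => /=.
Qed.

Section limits.
Variables (R : realType) (n : nat).
Local Notation Rn := 'rV[R]_n.
Local Notation mu := (lebesgue_rV R n).
Local Notation Re := (@complex.Re R).
Local Notation Im := (@complex.Im R).
Implicit Types f w g : Rn -> R[i].

Lemma fourierB f g xi : cintegrable f -> cintegrable g ->
  fourier (f - g) xi = fourier f xi - fourier g xi.
Proof.
move=> [fR fI] [gR gI].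
have cosi (u : Rn -> R) : mu.-integrable setT (EFin \o u) ->
    mu.-integrable setT (EFin \o (fun x => cos (dotp x xi) * u x)).
  by move=> ui; under eq_fun do rewrite dotpC; exact: integrable_cosM.
have sini (u : Rn -> R) : mu.-integrable setT (EFin \o u) ->
    mu.-integrable setT (EFin \o (fun x => sin (dotp x xi) * u x)).
  by move=> ui; under eq_fun do rewrite dotpC; exact: integrable_sinM.
apply: eq_Re_Im; rewrite ?ReB ?ImB.
- rewrite !Re_fourier -(RintegralB measurableT
    (integrableD measurableT (cosi _ fR) (sini _ fI))
    (integrableD measurableT (cosi _ gR) (sini _ gI))).
  by apply: eq_Rintegral => x _; rewrite !fctE ReB ImB; ring.
- rewrite !Im_fourier -(RintegralB measurableT
    (integrableB measurableT (cosi _ fI) (sini _ fR))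
    (integrableB measurableT (cosi _ gI) (sini _ gR))).
  by apply: eq_Rintegral => x _; rewrite !fctE ReB ImB; ring.
Qed.

(** The threshold A solves A^(s - t) = d. If <xi> >= A then <xi>^s = <xi>^(s - t) <xi>^t <= d
    <xi>^t. If <xi> < A then <xi>^s <= A^s, and 1 <= <xi>^(2 n) k(xi) <= A^(2 n) k(xi), whence the
    constant A^s A^(2 n). *)
Lemma japanese_interpolation (s t d : R) : 0 <= s -> s < t -> 0 < d ->
  exists2 C : R, 0 <= C & forall xi : Rn,
    japanese xi `^ s <= d * japanese xi `^ t + C * cauchy_kernel xi.
Proof.
move=> s0 st d0; pose A := d `^ ((s - t)^-1).
have A0 : 0 < A by exact: powR_gt0.
have st0 : s - t < 0 by rewrite subr_lt0.
exists (A `^ s * A ^+ n.*2) => [|xi].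
  by rewrite mulr_ge0 ?powR_ge0 ?exprn_ge0 ?(ltW A0).
set J := japanese xi; have J1 : 1 <= J := japanese_ge1 xi.
have J0 : 0 < J := japanese_gt0 xi.
have k0 : 0 < cauchy_kernel xi := cauchy_kernel_gt0 xi.
have [AJ|JA] := leP A J.
  apply: (@le_trans _ _ (d * J `^ t)); last first.
    by rewrite lerDl !mulr_ge0 ?powR_ge0 ?exprn_ge0 ?(ltW A0) ?(ltW k0).
  rewrite -[s in leLHS](subrK t) powRD; last by rewrite (gt_eqF J0) implybT.
  rewrite ler_wpM2r ?powR_ge0//.
  have -> : d = A `^ (s - t).
    by rewrite /A -powRrM mulVf ?lt_eqF// powRr1// ltW.
  rewrite -(opprB t s) !powRN lef_pV2 ?posrE ?powR_gt0//.
  have ts0 : 0 <= t - s by rewrite subr_ge0 ltW.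
  exact: (ge0_ler_powR ts0 (ltW A0 : A \is Num.nneg) (ltW J0 : J \is Num.nneg)).
apply: (@le_trans _ _ (A `^ s * A ^+ n.*2 * cauchy_kernel xi)); last first.
  by rewrite lerDr mulr_ge0 ?powR_ge0 ?(ltW d0).
rewrite -mulrA; apply: (@le_trans _ _ (A `^ s)).
  exact: (ge0_ler_powR s0 (ltW J0 : J \is Num.nneg) (ltW A0 : A \is Num.nneg) (ltW JA)).
rewrite ler_peMr ?powR_ge0//; apply: (le_trans (cauchy_kernel_japanese xi)).
by rewrite ler_wpM2r ?(ltW k0)// lerXn2r ?nnegrE ?(ltW A0) ?(ltW J0) ?(ltW JA).
Qed.

Section uniform_limit.
Variables (v : nat -> Rn -> R[i]) (eta : nat -> R).
Hypothesis eta0 : eta j @[j --> \oo] --> 0.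
Hypothesis veta : forall j l x, Normc.normc (v j x - v l x) <= eta j + eta l.

(** Letting l tend to infinity in the hypothesis removes [eta l] and leaves the explicit rate
    [eta j]. *)
Let cauchy_cvg1 (a : nat -> R) : (forall j l, `|a j - a l| <= eta j + eta l) ->
  exists2 l : R, a j @[j --> \oo] --> l & forall j, `|a j - l| <= eta j.
Proof.
move=> aeta.
have : cvgn a.
  apply: cauchy_cvg; apply/cauchy_exP => e e0.
  have e2 : 0 < e / 2 by rewrite divr_gt0.
  have near_eta : \forall j \near \oo, eta j < e / 2.
    move/cvgrPdist_lt : eta0 => /(_ _ e2); apply: filterS => j.
    by rewrite sub0r normrN; apply: le_lt_trans (ler_norm _).
  have [j0 hj0] := filter_ex near_eta; exists (a j0).
  have : \forall j \near \oo, ball (a j0) e (a j).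
    apply: filterS near_eta => j hj; rewrite -ball_normE /=.
    by rewrite (le_lt_trans (aeta _ _))// (splitr e) ltrD.
  by [].
move=> /cvg_ex[l al]; exists l => // j.
have h1 : (fun k => `|a j - a k|) @ \oo --> `|a j - l|.
  by apply: cvg_norm; apply: cvgB => //; exact: cvg_cst.
have h2 : (fun k => eta j + eta k) @ \oo --> eta j + 0.
  by apply: cvgD => //; exact: cvg_cst.
rewrite addr0 in h2.
by apply: (ler_cvg_to h1 h2); exact: nearW.
Qed.

Lemma uniform_limit : exists f : Rn -> R[i],
  forall j x, Normc.normc (v j x - f x) <= 2 * eta j.
Proof.
have /choice[a ha] : forall x, exists l : R, forall j, `|Re (v j x) - l| <= eta j.
  move=> x; have [|l _ hl] := @cauchy_cvg1 (fun j => Re (v j x)); last by exists l.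
  by move=> j l; rewrite -ReB; exact: (le_trans (normRe_le _) (veta j l x)).
have /choice[b hb] : forall x, exists l : R, forall j, `|Im (v j x) - l| <= eta j.
  move=> x; have [|l _ hl] := @cauchy_cvg1 (fun j => Im (v j x)); last by exists l.
  by move=> j l; rewrite -ImB; exact: (le_trans (normIm_le _) (veta j l x)).
exists (fun x => a x +i* b x) => j x.
apply: (le_trans (normc_le _)); rewrite ReB ImB mulr_natl mulr2n.
exact: lerD.
Qed.

(** Outside the box all v j vanish, so f does too; one v j at finite uniform distance bounds f;
    continuity is the e / 3 argument. *)
Lemma compactly_supported_limit (r : R) (f : Rn -> R[i]) (c : R) :
  (forall j, compactly_supported r (v j)) ->
  (forall j x, Normc.normc (v j x - f x) <= c * eta j) -> compactly_supported r f.
Proof.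
move=> sv vf.
have ceta : c * eta j @[j --> \oo] --> 0.
  by rewrite -(mulr0 c); apply: cvgM => //; exact: cvg_cst.
have small e : 0 < e -> exists j, c * eta j < e.
  move=> e0; have := ceta => /cvgrPdist_lt /(_ _ e0)/filter_ex[j hj]; exists j.
  by move: hj; rewrite sub0r normrN; exact: le_lt_trans (ler_norm _).
have [M fM] := compactly_supported_bounded (sv 0%N).
split; last first.
  move=> x; apply: contraNP => /existsNP[i /negP xi].
  have v0 j : v j x = 0.
    by have [//|vx] := eqVneq (v j x) 0; have := (sv j).2 x vx i; rewrite (negbTE xi).
  apply/eqP/Normc.eq0_normc/eqP; rewrite eq_le normc_ge0 andbT.
  apply/ler_addgt0Pr => e /small[j je]; rewrite add0r.
  by have := vf j x; rewrite v0 sub0r normcN => h; exact: (le_trans h (ltW je)).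
split; last first.
  exists (M + c * eta 0%N) => x; rewrite normc_leP.
  have -> : f x = v 0%N x - (v 0%N x - f x) by rewrite subKr.
  have := normcB_triangle (v 0%N x) 0 (v 0%N x - f x).
  by rewrite !subr0 sub0r normcN => /le_trans; apply; exact: lerD.
(* Stated for a difference-preserving h bounded by the modulus, so as to serve for both Re and
   Im. *)
have unif (h : R[i] -> R) : (forall z w : R[i], h (z - w) = h z - h w) ->
    (forall z : R[i], `|h z| <= Normc.normc z) ->
    (forall j, continuous (fun x => h (v j x))) -> continuous (fun x => h (f x)).
  move=> hB hn ch x; apply/(@cvgrPdist_lt _ _ _ (nbhs x)) => e e0.
  have e3 : 0 < e / 3 by rewrite divr_gt0.
  have [j je] := small _ e3.
  have := ch j x => /(@cvgrPdist_lt _ _ _ (nbhs x)) /(_ _ e3).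
  apply: filterS => y hy.
  have H z : `|h (v j z) - h (f z)| < e / 3.
    by rewrite -hB (le_lt_trans (hn _))// (le_lt_trans (vf j z)).
  have -> : h (f x) - h (f y) = - (h (v j x) - h (f x)) + (h (v j x) - h (v j y))
     + (h (v j y) - h (f y)) by ring.
  apply: (le_lt_trans (ler_normD _ _)).
  apply: (le_lt_trans (lerD (ler_normD _ _) (lexx _))).
  by rewrite normrN; have := H x; have := H y; move: hy; lra.
apply: continuous_complex.
- apply: (unif Re) => [z w|z|j]; [exact: ReB|exact: normRe_le|].
  by apply: continuous_Re; case: (sv j) => -[].
- apply: (unif Im) => [z w|z|j]; [exact: ImB|exact: normIm_le|].
  by apply: continuous_Im; case: (sv j) => -[].
Qed.

End uniform_limit.
End limits.

Section bounded_sequences.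
Variables (R : realType) (n : nat) (r s t M : R).
Hypotheses (r0 : 0 <= r) (s0 : 0 <= s) (st : s < t).
Local Notation Rn := 'rV[R]_n.
Local Notation mu := (lebesgue_rV R n).
Local Notation Re := (@complex.Re R).
Local Notation Im := (@complex.Im R).
Variable u : nat -> Rn -> R[i].
Hypothesis su : forall k, compactly_supported r (u k).
Hypothesis iu : forall k, mu.-integrable setT (EFin \o weighted t (fourier (u k))).
Hypothesis uM : forall k, (\int[mu]_xi (weighted t (fourier (u k)) xi)%:E <= M%:E)%E.

Let t0 : 0 <= t. Proof. exact: (le_trans s0 (ltW st)). Qed.
Let Fu k := fourier (u k).
Let mFu k : cmeasurable (Fu k). Proof. exact: cmeasurable_fourier (su k). Qed.

Let K0 : R := 4 * (2 ^+ n * pi ^+ n)^-1.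

Let K0_ge0 : 0 <= K0.
Proof. by rewrite mulr_ge0// invr_ge0 mulr_ge0// exprn_ge0// pi_ge0. Qed.

Let integral_le_fine (f : Rn -> R) (c : R) : (forall x, 0 <= f x) ->
  (\int[mu]_x (f x)%:E <= c%:E)%E -> \int[mu]_x f x <= c.
Proof.
move=> f0 h; rewrite -lee_fin fineK// ge0_fin_numE; last first.
  by apply: integral_ge0 => x _; rewrite lee_fin.
by apply: le_lt_trans h _; exact: ltry.
Qed.

(** The norm bound controls the functions themselves, since <xi>^t >= 1. This uniform bound, with
    the common box, yields the constants [Q] and [L] valid for all the transforms. *)
Let sup_u k x : Normc.normc (u k x) <= K0 * M.
Proof.
have [ci ni] := cintegrable_weighted0 t0 (mFu k) (iu k).
apply: (le_trans (sup_le_fourier r0 x (su k) ci)); rewrite ler_wpM2l//.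
apply: (@le_trans _ _ (\int[mu]_xi weighted t (Fu k) xi)).
  by apply: le_Rintegral => //; [exact: iu|move=> xi _; exact: le_normc_weighted].
by apply: integral_le_fine; [exact: weighted_ge0|exact: uM].
Qed.

Let D : R := (1 + r ^+ 2) ^+ n.
Let Q : R := 2 * (K0 * M) * D * pi ^+ n.

Let M0 : 0 <= K0 * M.
Proof. exact: (le_trans (normc_ge0 _) (sup_u 0%N 0)). Qed.

Let D0 : 0 <= D.
Proof. by rewrite exprn_ge0// addr_ge0// sqr_ge0. Qed.

Let pin0 : 0 <= pi ^+ n :> R. Proof. by rewrite exprn_ge0// pi_ge0. Qed.

(** The boolean index treats real and imaginary parts as one family, so that a single extraction
    makes both converge. *)
Let part (c : bool) (z : R[i]) : R := if c then Re z else Im z.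

Let part_bound k c xi : `|part c (Fu k xi)| <= Q.
Proof. by have [h1 h2] := fourier_bound r0 (su k) (sup_u k) xi; case: c. Qed.

Let L := r * (2 * (K0 * M) * D) * pi ^+ n.

Let L0 : 0 <= L. Proof. by rewrite /L (mulr_ge0 (mulr_ge0 r0 (mulr_ge0 (mulr_ge0 _ M0) D0)) pin0). Qed.

Let part_lipschitz k c x y :
  `|part c (Fu k x) - part c (Fu k y)| <= L * \sum_i `|x ord0 i - y ord0 i|.
Proof.
have -> : L * \sum_i `|x ord0 i - y ord0 i| =
  r * (\sum_i `|x ord0 i - y ord0 i|) * (2 * (K0 * M) * D) * pi ^+ n.
  by rewrite /L; ring.
by have [h1 h2] := fourier_lipschitz r0 (su k) (sup_u k) x y; case: c.
Qed.

Section limit_along.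
Variables (sigma : nat -> nat) (p : bool -> Rn -> R).
Hypothesis cvgp : forall c xi, part c (Fu (sigma j) xi) @[j --> \oo] --> p c xi.

Let v j := u (sigma j).
Let Fv j := Fu (sigma j).
Let G xi : R[i] := p true xi +i* p false xi.

Let mG : cmeasurable G.
Proof.
split.
- apply: (@measurable_realfun.measurable_fun_cvg _ _ _ _ (fun j xi => Re (Fv j xi))).
    by move=> j; exact: (mFu _).1.
  by move=> xi _; exact: (@cvgp true xi).
- apply: (@measurable_realfun.measurable_fun_cvg _ _ _ _ (fun j xi => Im (Fv j xi))).
    by move=> j; exact: (mFu _).2.
  by move=> xi _; exact: (@cvgp false xi).
Qed.

Let N j xi := Normc.normc (Fv j xi - G xi).

Let mFG j : cmeasurable (fun xi => Fv j xi - G xi).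
Proof.
have [m1 m2] := mFu (sigma j); have [m3 m4] := mG; split.
- by under eq_fun do rewrite ReB; exact: measurable_funB.
- by under eq_fun do rewrite ImB; exact: measurable_funB.
Qed.

Let N_cvg xi : N j xi @[j --> \oo] --> 0.
Proof.
have hR : `|Re (Fv j xi) - p true xi| @[j --> \oo] --> 0.
  apply/norm_cvg0P; rewrite -(subrr (p true xi)).
  by apply: cvgB; [exact: (@cvgp true xi)|exact: cvg_cst].
have hI : `|Im (Fv j xi) - p false xi| @[j --> \oo] --> 0.
  apply/norm_cvg0P; rewrite -(subrr (p false xi)).
  by apply: cvgB; [exact: (@cvgp false xi)|exact: cvg_cst].
have h := cvgD hR hI; rewrite addr0 in h.
apply: (@squeeze_cvgr _ _ _ _ (fun=> 0)
  (fun j => `|Re (Fv j xi) - p true xi| + `|Im (Fv j xi) - p false xi|));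
  [|exact: cvg_cst|exact: h].
apply: nearW => j; rewrite normc_ge0 /=.
by apply: (le_trans (normc_le _)); rewrite ReB ImB.
Qed.

Let part_p_bound c xi : `|p c xi| <= Q.
Proof.
by apply: (cvgr_to_le (cvg_norm (@cvgp c xi))); apply: nearW => j; exact: part_bound.
Qed.

Let N_bound j xi : N j xi <= 4 * Q.
Proof.
apply: (le_trans (normc_le _)); rewrite ReB ImB /=.
have h1 := part_bound (sigma j) true xi; have h2 := part_bound (sigma j) false xi.
have h3 := part_p_bound true xi; have h4 := part_p_bound false xi.
have a1 := ler_normB (Re (Fv j xi)) (p true xi).
have a2 := ler_normB (Im (Fv j xi)) (p false xi).
apply: (le_trans (lerD a1 a2)); move: h1 h2 h3 h4 => /=.
rewrite -/(Fv j); lra.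
Qed.

(** Fatou transfers the bound in the weight t to [G]. It supplies the bound 2 M on the differences
    that the interpolation multiplies by a small d. *)
Let weighted_G : mu.-integrable setT (EFin \o weighted t G) /\
  \int[mu]_xi weighted t G xi <= M.
Proof.
have h : (\int[mu]_xi (weighted t G xi)%:E <= M%:E)%E.
  apply: (@fatou_bound _ _ _ _ (fun j => weighted t (Fv j))) => [j|j x|xi|j].
  - exact: (measurable_weighted t (mFu (sigma j))).
  - exact: weighted_ge0.
  - apply: cvgM; first exact: cvg_cst.
    apply/cvgrPdist_lt => e e0.
    move/cvgrPdist_lt : (N_cvg xi) => /(_ _ e0); apply: filterS => j.
    rewrite sub0r normrN ger0_norm ?normc_ge0//; apply: le_lt_trans.
    by rewrite distrC; exact: normcB_norm_le.
  - exact: uM.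
split; last by apply: integral_le_fine => //; exact: weighted_ge0.
apply/integrableP; split.
  by apply/measurable_EFinP; exact: (measurable_weighted t mG).
under eq_integral do rewrite gee0_abs ?lee_fin ?weighted_ge0//.
by apply: le_lt_trans h _; exact: ltry.
Qed.

(** This turns out to be [Bnorm s (v j - f)] once [G] is recognised as [fourier f], but it has to
    tend to 0 before f can be constructed. *)
Let eta j := \int[mu]_xi weighted s (fun xi => Fv j xi - G xi) xi.

Let le_weighted_diff w j xi : weighted w (fun xi => Fv j xi - G xi) xi <=
  weighted w (Fv j) xi + weighted w G xi.
Proof.
rewrite /weighted -mulrDr ler_wpM2l ?powR_ge0//.
by have := normcB_triangle (Fv j xi) 0 (G xi); rewrite subr0 sub0r normcN.
Qed.

Let weighted_t_diff j :
  mu.-integrable setT (EFin \o weighted t (fun xi => Fv j xi - G xi)) /\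
  \int[mu]_xi weighted t (fun xi => Fv j xi - G xi) xi <= 2 * M.
Proof.
have [iG GM] := weighted_G.
have iD := integrableD measurableT (iu (sigma j)) iG.
have iw : mu.-integrable setT (EFin \o weighted t (fun xi => Fv j xi - G xi)).
  apply: (le_integrable measurableT _ _ iD).
    by apply/measurable_EFinP; exact: (measurable_weighted t (mFG j)).
  move=> xi _; rewrite /= lee_fin ger0_norm ?weighted_ge0//.
  rewrite [leRHS]ger0_norm ?addr_ge0 ?weighted_ge0//.
split => //.
apply: (@le_trans _ _ (\int[mu]_xi (weighted t (Fv j) xi + weighted t G xi))).
  apply: le_Rintegral => // xi _; exact: (@le_weighted_diff t j xi).
rewrite (RintegralD measurableT (iu (sigma j)) iG) mulr_natl mulr2n lerD//.
by apply: integral_le_fine; [exact: weighted_ge0|exact: uM].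
Qed.

Let iw_s j : mu.-integrable setT (EFin \o weighted s (fun xi => Fv j xi - G xi)).
Proof.
exact: (le_integrable_weighted (ltW st) (mFG j) (weighted_t_diff j).1).
Qed.

Let eta_ge0 j : 0 <= eta j.
Proof. by apply: Rintegral_ge0 => xi _; exact: weighted_ge0. Qed.

Let eta_cvg : eta j @[j --> \oo] --> 0.
Proof.
have Mge0 : 0 <= M.
  rewrite -lee_fin; apply: le_trans (uM 0%N).
  by apply: integral_ge0 => x _; rewrite lee_fin weighted_ge0.
have Q0 : 0 <= Q by exact: le_trans (normr_ge0 _) (part_bound 0%N true 0).
have mN j : measurable_fun setT (N j).
  by have [m1 m2] := mFG j; exact: measurable_normc.
have mk := @measurable_cauchy_kernel R n.
have Nk_le j xi : `|N j xi * cauchy_kernel xi| <= 4 * Q * cauchy_kernel xi.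
  have k0 := ltW (cauchy_kernel_gt0 xi).
  by rewrite ger0_norm ?mulr_ge0 ?normc_ge0// ler_wpM2r// N_bound.
have i4 : mu.-integrable setT (EFin \o (fun xi : Rn => 4 * Q * cauchy_kernel xi)).
  exact: (integrableZl measurableT (4 * Q) (integrable_cauchy_kernel R n)).
(* The kernel supplies the integrable majorant 4 Q k, since the differences N are bounded only by a
   constant. *)
have [|||//|_ Nk] := @Rintegral_dominated_cvg _ _ R mu (fun j xi => N j xi * cauchy_kernel xi)
  (fun=> 0) (fun xi => 4 * Q * cauchy_kernel xi).
- by move=> j; exact: measurable_funM.
- move=> xi; rewrite -(mul0r (cauchy_kernel xi)).
  by apply: cvgM; [exact: N_cvg|exact: cvg_cst].
- exact: i4.
rewrite Rintegral_cst// mul0r in Nk.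
apply/cvgrPdist_lt => e e0.
(* Makes d (2 M) at most e / 2; the + 4 covers M = 0. *)
pose d := e / (4 * M + 4).
have d0 : 0 < d by rewrite divr_gt0// ltr_wpDl// mulr_ge0.
have [C C0 HC] := japanese_interpolation n s0 st d0.
have e2 : 0 < e / 2 by rewrite divr_gt0.
have : (fun j => C * \int[mu]_xi (N j xi * cauchy_kernel xi)) @ \oo --> C * 0.
  by apply: cvgM => //; exact: cvg_cst.
rewrite mulr0 => /cvgrPdist_lt /(_ _ e2); apply: filterS => j.
rewrite !sub0r !normrN (ger0_norm (eta_ge0 j)) => hj.
have iNk : mu.-integrable setT (EFin \o (fun xi => N j xi * cauchy_kernel xi)).
  apply: (le_integrable measurableT _ _ i4).
    by apply/measurable_EFinP; exact: measurable_funM.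
  by move=> xi _; rewrite lee_fin (le_trans (Nk_le j xi))// ler_norm.
have [iwt wt] := weighted_t_diff j.
have h1 := integrableZl measurableT d iwt.
have h2 := integrableZl measurableT C iNk.
have step : eta j <= d * (2 * M) + C * \int[mu]_xi (N j xi * cauchy_kernel xi).
  apply: (@le_trans _ _ (d * \int[mu]_xi weighted t (fun xi => Fv j xi - G xi) xi +
      C * \int[mu]_xi (N j xi * cauchy_kernel xi))); last first.
    by rewrite lerD2r ler_wpM2l// ltW.
  rewrite -(RintegralZl d measurableT iwt) -(RintegralZl C measurableT iNk).
  rewrite -(RintegralD measurableT h1 h2).
  apply: (le_Rintegral measurableT (iw_s j) (integrableD measurableT h1 h2)).
  move=> xi _; rewrite /weighted -/(N j xi).
  have N0 : 0 <= N j xi by exact: normc_ge0.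
  have -> : d * (japanese xi `^ t * N j xi) + C * (N j xi * cauchy_kernel xi) =
    (d * japanese xi `^ t + C * cauchy_kernel xi) * N j xi by ring.
  by rewrite ler_wpM2r.
apply: (le_lt_trans step); rewrite (splitr e); apply: ler_ltD; last first.
  by apply: le_lt_trans hj; exact: ler_norm.
have M4 : 0 < 4 * M + 4 by rewrite ltr_wpDl// mulr_ge0.
have -> : d * (2 * M) = e / 2 * (4 * M / (4 * M + 4)).
  by rewrite /d; field; rewrite gt_eqF.
by rewrite ler_piMr ?(ltW e2)// ler_pdivrMr// mul1r lerDl.
Qed.

Let fourier_vB j l xi : fourier (v j - v l) xi = Fv j xi - Fv l xi.
Proof. by apply: fourierB; exact: (cintegrable_cs r0 (su _)). Qed.

(** The transform of v j - v l is the difference of Fv j - G and Fv l - G, so the sup bound applies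
    to it. The unknown limit [G] thus gives a Cauchy estimate for the functions before any limit
    function is available. *)
Let v_cauchy j l x : Normc.normc (v j x - v l x) <= K0 * eta j + K0 * eta l.
Proof.
have sB := compactly_supportedB (su (sigma j)) (su (sigma l)).
have [cj nj] := cintegrable_weighted0 s0 (mFG j) (iw_s j).
have [cl nl] := cintegrable_weighted0 s0 (mFG l) (iw_s l).
have E : fourier (v j - v l) = fun xi => (Fv j xi - G xi) - (Fv l xi - G xi).
  by apply/funext => xi; rewrite fourier_vB opprB addrA subrK.
have cB : cintegrable (fourier (v j - v l)).
  rewrite E; have [[c1 c2] [c3 c4]] := (cj, cl); split.
  - by under eq_fun do rewrite ReB; exact: (integrableB measurableT c1 c3).
  - by under eq_fun do rewrite ImB; exact: (integrableB measurableT c2 c4).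
apply: (le_trans (sup_le_fourier r0 x sB cB)).
rewrite -mulrDr ler_wpM2l//.
have iD := integrableD measurableT (iw_s j) (iw_s l).
have B xi : Normc.normc (fourier (v j - v l) xi) <=
    weighted s (fun xi => Fv j xi - G xi) xi + weighted s (fun xi => Fv l xi - G xi) xi.
  rewrite E; have := normcB_triangle (Fv j xi - G xi) 0 (Fv l xi - G xi).
  rewrite subr0 sub0r normcN => /le_trans; apply.
  by apply: lerD; exact: (le_normc_weighted (fun xi => _ xi - G xi)).
have iB : mu.-integrable setT (EFin \o (fun xi => Normc.normc (fourier (v j - v l) xi))).
  apply: (le_integrable measurableT _ _ iD).
    apply/measurable_EFinP.
    by have [m1 m2] := cmeasurable_fourier r0 sB; exact: measurable_normc.
  move=> xi _; rewrite /= lee_fin ger0_norm ?normc_ge0//.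
  by rewrite [leRHS]ger0_norm ?addr_ge0 ?weighted_ge0 ?B.
rewrite /eta -(RintegralD measurableT (iw_s j) (iw_s l)).
by apply: le_Rintegral => // xi _; exact: B.
Qed.

Lemma limit_in_Bspace : exists2 f, Bspace s f &
  (Bnorm s (v j - f) @[j --> \oo] --> 0%E).
Proof.
have Keta : K0 * eta j @[j --> \oo] --> 0.
  by rewrite -(mulr0 K0); apply: cvgM; [exact: cvg_cst|exact: eta_cvg].
have [f vf] := uniform_limit Keta v_cauchy.
have sf : compactly_supported r f.
  by apply: (compactly_supported_limit Keta _ vf) => j; exact: su.
have vf_cs j := compactly_supportedB (su (sigma j)) sf.
have fvf j xi : fourier (v j - f) xi = Fv j xi - fourier f xi.
  by apply: fourierB; [exact: (cintegrable_cs r0 (su _))|exact: (cintegrable_cs r0 sf)].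
(* The transform of v j - f is bounded by a constant times the sup of |v j - f|, which tends to 0.
   So [fourier (v j)] converges pointwise to [fourier f] as well as to [G], and the two agree
   everywhere. *)
have fG : fourier f = G.
  apply/funext => xi.
  have lim0 : 2 * (2 * (K0 * eta j)) * D * pi ^+ n @[j --> \oo] --> 0.
    rewrite (_ : (fun _ => _) = fun j => 4 * D * pi ^+ n * (K0 * eta j)).
      by rewrite -(mulr0 (4 * D * pi ^+ n)); apply: cvgM => //; exact: cvg_cst.
    by apply/funext => j; ring.
  have H c : part c (fourier f xi) = p c xi.
    apply/eqP; rewrite -subr_eq0 -normr_eq0; apply/eqP.
    have h1 : (fun j => `|part c (fourier f xi) - part c (Fv j xi)|) @ \oo -->
        `|part c (fourier f xi) - p c xi|.
      by apply: cvg_norm; apply: cvgB; [exact: cvg_cst|exact: (@cvgp c xi)].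
    have h2 : (fun j => `|part c (fourier f xi) - part c (Fv j xi)|) @ \oo --> 0.
      apply: (@squeeze_cvgr _ _ _ _ (fun=> 0)
        (fun j => 2 * (2 * (K0 * eta j)) * D * pi ^+ n)); [|exact: cvg_cst|exact: lim0].
      apply: nearW => j; rewrite normr_ge0 /= distrC.
      have [b1 b2] := fourier_bound r0 (vf_cs j) (vf j) xi.
      by rewrite fvf ReB ImB in b1 b2; case: c {h1}.
    exact: (cvg_unique _ h1 h2).
  by apply: eq_Re_Im; [exact: (H true)|exact: (H false)].
have cmf := cmeasurable_fourier r0 sf.
(* Integrability of [fourier f] follows from that of [G], and makes it a distributional transform of
   f; only then does f qualify for [Bspace s]. *)
have iG := weighted_G.1; rewrite -fG in iG.
have [cf _] := cintegrable_weighted0 t0 cmf iG.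
have ff := is_fourier_classical r0 sf cf.
exists f.
  split; [exact: sf.1|by exists (fourier f)|].
  apply/cintegrable_weightedP; first by apply: cmeasurable_fhat; exists (fourier f).
  apply/(integrable_weighted_fhat r0) => //; first by exists (fourier f).
  exact: (le_integrable_weighted (ltW st) cmf iG).
have E j : Bnorm s (v j - f) = (eta j)%:E.
  have F : fourier (v j - f) = fun xi => Fv j xi - G xi.
    by apply/funext => xi; rewrite fvf fG.
  rewrite (Bnorm_cs r0 s (vf_cs j)).
    by rewrite F /eta /Rintegral fineK//; exact: (integrable_fin_num measurableT (iw_s j)).
  exists (fourier (v j - f)); apply: (is_fourier_classical r0 (vf_cs j)).
  by rewrite F; exact: (cintegrable_weighted0 s0 (mFG j) (iw_s j)).1.
under eq_cvg do rewrite E.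
by apply: cvg_EFin; [exact: nearW|exact: eta_cvg].
Qed.

End limit_along.

Lemma bounded_subsequence : exists2 sigma : nat -> nat,
  {homo sigma : i j / (i < j)%N} &
  exists2 f, Bspace s f & (Bnorm s (u (sigma j) - f) @[j --> \oo] --> 0%E).
Proof.
have [sigma hs [p cvgp]] := pointwise_subsequence L0
  (F := fun k c xi => part c (Fu k xi)) part_bound part_lipschitz.
by exists sigma => //; exact: (limit_in_Bspace cvgp).
Qed.

End bounded_sequences.

Theorem theorem2p1 (R : realType) (n : nat) (K : set 'rV[R]_n) (s t : R)
    (cK : compact K) (s_ge0 : 0 <= s) (s_lt_t : s < t) :
  compact_embedding (BspaceK K t) (Bnorm t) (Bspace s) (Bnorm s).
Proof.
have st := ltW s_lt_t; split.
- by move=> f [Bf _]; exact: (Bspace_le st).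
(* The constant is 1 because <xi> >= 1 makes the weight increasing in its exponent. *)
- by exists 1 => f [Bf _]; rewrite mul1e; exact: Bnorm_le.
move=> u uB [M uM]; have [r r0 Kr] := compact_subset_box cK.
have su k : compactly_supported r (u k).
  have [[bu _ _] uK] := uB k; split => // x ux.
  by apply/Kr/uK; exact: subset_closure.
have eu k : exists g, is_fourier (u k) g by have [[]] := uB k.
apply: (bounded_subsequence (t := t) (M := M) r0) => // k.
- have [[_ _ cu] _] := uB k.
  apply/(integrable_weighted_fhat r0) => //.
  by apply/cintegrable_weightedP => //; exact: cmeasurable_fhat.
- by rewrite -(Bnorm_cs r0 t (su k) (eu k)).
Qed.
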